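(* Let $H$ be a finite-dimensional non-cosemisimple Hopf algebra over $\Bbbk$, with a block system $H=\bigoplus_{n\ge 0,\,d_1,d_2\ge 1}B^{d_1,d_2}_n$. Let $d_1,d_2\ge 1$. Then: (1) if $B^{d_1,d_2}_n\ne 0$ for some $n>1$, then there exists a set of positive integers $\{b_1,\dots,b_{n-1}\}$ such that $B^{d_1,b_i}_i\ne 0$ and $B^{b_i,d_2}_{n-i}\ne 0$ for all $i=1,\dots,n-1$; (2) if $B^{d_1,d_2}_n\ne 0$ for some $n\ge 1$, then $B^{d_2,d_1}_n\ne 0$; (3) if $B^{d_1,d_2}_{n_1}\ne 0$ for some $n_1\ge 1$ and $d_1\ne d_2$, then there exists a positive integer $d_3$ such that $B^{d_1,d_3}_{n_2}\ne 0$ for some $n_2\ge n_1+1$.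
   Context: $\Bbbk$ is an algebraically closed field of characteristic $0$. A coalgebra is cosemisimple if it equals its coradical. Block systems. Let $C$ be a non-cosemisimple coalgebra (here the coalgebra underlying $H$) with coradical filtration $\{C_n\}_{n\ge 0}$. There is a coalgebra projection $\pi:C\to C_0$ onto the coradical whose kernel $I=\ker\pi$ is a coideal with $C=C_0\oplus I$; fix such $\pi$ and $I$. Put $\rho_L=(\pi\otimes \mathrm{id})\Delta$ and $\rho_R=(\mathrm{id}\otimes\pi)\Delta$; these make $C$ a $C_0$-bicomodule. Put $P_n=C_n\cap I$, a $C_0$-subbicomodule. Let $\widehat C$ index the simple subcoalgebras $D_\tau$ of $C$, with $\dim D_\tau=d_\tau^2$; let $V_\tau$ be the simple right $D_\tau$-comodule and $V_\tau^*$ the simple left $D_\tau$-comodule. The category of $C_0$-bicomodules is semisimple, and for a $C_0$-bicomodule $M$ one writes $M^{\tau,\mu}$ for the sum of the simple subbicomodules of $M$ isomorphic to $V_\tau^*\otimes V_\mu$, so $M=\bigoplus_{\tau,\mu\in\widehat C}M^{\tau,\mu}$. For each $n\ge 1$ choose a $C_0$-subbicomodule $Q_n\subseteq P_n$ with $P_n=P_{n-1}\oplus Q_n$ (so $Q_n\cong C_n/C_{n-1}$). The blocks (derived from $I$ and $\{Q_n\}$) are: $B^{d,d}_0=\bigoplus_{\tau\in\widehat C,\,d_\tau=d}D_\tau$; $B^{d_1,d_2}_0=0$ if $d_1\neq d_2$; and, for $n\ge 1$, $B^{d_1,d_2}_n=\bigoplus_{\tau,\mu\in\widehat C,\ d_\tau=d_1,\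 d_\mu=d_2}Q_n^{\tau,\mu}$. The decomposition $C=\bigoplus_{n\ge 0,\,d_1,d_2\ge 1}B_n^{d_1,d_2}$ is called a block system of $C$. *)

(* Defs.v *)
From HB Require Import structures.
From mathcomp Require Import all_boot all_order all_algebra all_field.
From mathcomp Require Import boolp.

Set Implicit Arguments.
Unset Strict Implicit.
Unset Printing Implicit Defensive.

Import GRing.Theory.
Local Open Scope ring_scope.

Reserved Notation "u ⊗ v" (at level 40, left associativity).

Section VectorSpaces.
Variable k : fieldType.
Implicit Types U V W : vectType k.

(* The sum of a possibly infinite family of subspaces, given as a predicate.
   By finite dimension it is the sum of finitely many members. *)
Definition is_vsum V (P : {vspace V} -> Prop) (X : {vspace V}) : Prop :=
  (forall A, P A -> (A <= X)%VS) /\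
  (exists2 s : seq {vspace V},
     forall A, A \in s -> P A & X = (\sum_(A <- s) A)%VS).

Lemma is_vsum_ex V (P : {vspace V} -> Prop) : exists X, is_vsum P X.
Proof.
pose fin X := exists2 s : seq {vspace V},
  forall A, A \in s -> P A & X = (\sum_(A <- s) A)%VS.
suff: forall m X, fin X -> (\dim {:V} - \dim X <= m)%N -> exists X, is_vsum P X.
  move=> /(_ (\dim {:V} - \dim (0%VS : {vspace V}))%N 0%VS); apply => //.
  by exists [::]; rewrite ?big_nil.
elim=> [|m IHm] X finX dimX.
  exists X; split=> // A _; suff ->: X = fullv by rewrite subvf.
  by apply/eqP; rewrite eqEdim subvf -subn_eq0 -leqn0.
have [subX|] := pselect (forall A, P A -> (A <= X)%VS); first by exists X.
move=> /existsNP[A /not_implyP[PA /negP nAX]].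
have [s sP defX] := finX.
apply: (IHm (A + X)%VS).
  exists (A :: s); last by rewrite big_cons defX.
  by move=> B; rewrite inE => /predU1P[->|/sP].
have ltX: (\dim X < \dim (A + X))%N.
  rewrite ltn_neqAle dimvS ?addvSr // andbT; apply: contra nAX => /eqP eqd.
  have /eqP->: X == (A + X)%VS by rewrite eqEdim addvSr eqd leqnn.
  exact: addvSl.
move: dimX; rewrite !leq_subLR => /leq_trans; apply.
by rewrite addnS -addSn leq_add2r.
Qed.

Definition vsum V (P : {vspace V} -> Prop) : {vspace V} :=
  sval (cid (is_vsum_ex P)).

Lemma vsumP V (P : {vspace V} -> Prop) : is_vsum P (vsum P).
Proof. exact: svalP (cid (is_vsum_ex P)). Qed.

(* Tensor products are realized in coordinates, as matrices; [tpureE],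
   [tliftE] and [tens_ext] give the usual universal property. *)
Definition tens U V : vectType k := 'M[k]_(\dim {:U}, \dim {:V}).

Definition tpure U V (u : U) (v : V) : tens U V :=
  \matrix_(i, j) (coord (vbasis {:U}) i u * coord (vbasis {:V}) j v).

Local Notation "u ⊗ v" := (tpure u v) : ring_scope.

Definition tlift U V W (b : U -> V -> W) : 'Hom(tens U V, W) :=
  linfun (fun t : 'M[k]_(\dim {:U}, \dim {:V}) =>
    \sum_i \sum_j t i j *: b (vbasis {:U})`_i (vbasis {:V})`_j).

Definition tmap U V U' V' (f : 'Hom(U, U')) (g : 'Hom(V, V')) :
    'Hom(tens U V, tens U' V') :=
  tlift (fun u v => f u ⊗ g v).

Definition tassoc U V W : 'Hom(tens (tens U V) W, tens U (tens V W)) :=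
  tlift (fun s w => tlift (fun u v => u ⊗ (v ⊗ w)) s).

Definition tassoc_inv U V W : 'Hom(tens U (tens V W), tens (tens U V) W) :=
  tlift (fun u s => tlift (fun v w => (u ⊗ v) ⊗ w) s).

Definition tensv U V (A : {vspace U}) (B : {vspace V}) : {vspace tens U V} :=
  <<[seq u ⊗ v | u <- vbasis A, v <- vbasis B]>>%VS.

Definition dual V : vectType k := 'Hom(V, k^o).

Lemma tpure_linearl U V (v : V) : linear (fun u : U => u ⊗ v).
Proof. by move=> a x y; apply/matrixP=> i j; rewrite !mxE linearP mulrDl mulrA. Qed.

Lemma tpure_linearr U V (u : U) : linear (fun v : V => u ⊗ v).
Proof.
by move=> a x y; apply/matrixP=> i j; rewrite !mxE linearP mulrDr mulrCA.
Qed.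

HB.instance Definition _ U V (u : U) :=
  GRing.isLinear.Build k V (tens U V) _ (tpure u) (tpure_linearr u).

Lemma tpure_suml U V (I : Type) (r : seq I) (F : I -> U) (v : V) :
  (\sum_(i <- r) F i) ⊗ v = \sum_(i <- r) F i ⊗ v.
Proof.
elim: r => [|i r IHr]; last first.
  by rewrite !big_cons -IHr -[F i]scale1r tpure_linearl !scale1r.
by rewrite !big_nil; apply/matrixP=> i j; rewrite !mxE linear0 mul0r.
Qed.

Lemma tpureZl U V a (u : U) (v : V) : (a *: u) ⊗ v = a *: (u ⊗ v).
Proof. by apply/matrixP=> i j; rewrite !mxE linearZ mulrA. Qed.

Lemma tlift_def U V W (b : U -> V -> W) (t : tens U V) :
  tlift b t = \sum_i \sum_j
    (t : 'M[k]_(\dim {:U}, \dim {:V})) i j *: b (vbasis {:U})`_i (vbasis {:V})`_j.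
Proof.
pose F (t : 'M[k]_(\dim {:U}, \dim {:V})) :=
  \sum_i \sum_j t i j *: b (vbasis {:U})`_i (vbasis {:V})`_j.
have F_lin : linear F.
  move=> a x y; rewrite /F scaler_sumr -big_split; apply: eq_bigr => i _ /=.
  rewrite scaler_sumr -big_split; apply: eq_bigr => j _ /=.
  by rewrite !mxE scalerDl scalerA.
pose FL := GRing.isLinear.Build k 'M[k]_(\dim {:U}, \dim {:V}) W _ F F_lin.
pose F' : {linear 'M[k]_(\dim {:U}, \dim {:V}) -> W} := HB.pack F FL.
exact: (lfunE F' t).
Qed.

Lemma tliftE U V W (b : U -> V -> W) u v :
    (forall y, linear (fun x => b x y)) -> (forall x, linear (b x)) ->
  tlift b (u ⊗ v) = b u v.
Proof.
move=> bl br; rewrite tlift_def.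
have blD y : {morph (fun x => b x y) : x x' / x + x'}.
  by move=> x x' /=; rewrite -[x]scale1r bl !scale1r.
have bl0 y : b 0 y = 0.
  by apply: (addrI (b 0 y)); rewrite -blD !addr0.
have blZ a x y : b (a *: x) y = a *: b x y by rewrite -[a *: x]addr0 bl bl0 addr0.
have brD x : {morph b x : y y' / y + y'}.
  by move=> y y' /=; rewrite -[y]scale1r br !scale1r.
have br0 x : b x 0 = 0.
  by apply: (addrI (b x 0)); rewrite -brD !addr0.
have brZ a x y : b x (a *: y) = a *: b x y by rewrite -[a *: y]addr0 br br0 addr0.
rewrite {2}(coord_vbasis (memvf u)) (big_morph _ (blD v) (bl0 v)).
apply: eq_bigr => i _; rewrite blZ {2}(coord_vbasis (memvf v)).
rewrite (big_morph _ (brD _) (br0 _)) scaler_sumr; apply: eq_bigr => j _.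
by rewrite brZ scalerA mxE.
Qed.

Lemma tpureE U V (t : tens U V) :
  t = \sum_i \sum_j (t : 'M[k]_(\dim {:U}, \dim {:V})) i j *:
        ((vbasis {:U})`_i ⊗ (vbasis {:V})`_j).
Proof.
apply/matrixP=> i j; rewrite summxE (bigD1 i) //= summxE (bigD1 j) //=.
have frU := basis_free (vbasisP {:U}); have frV := basis_free (vbasisP {:V}).
rewrite !mxE !coord_free // !eqxx !mulr1 !big1 ?addr0 //.
  move=> i' ni; rewrite summxE big1 // => j' _.
  by rewrite !mxE !coord_free // (negPf ni) mul0r mulr0.
by move=> j' nj; rewrite !mxE !coord_free // (negPf nj) !mulr0.
Qed.

Lemma tens_ext U V W (f g : 'Hom(tens U V, W)) :
  (forall u v, f (u ⊗ v) = g (u ⊗ v)) -> f = g.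
Proof.
move=> fg; apply/lfunP=> t; rewrite (tpureE t) !linear_sum; apply: eq_bigr=> i _.
by rewrite !linear_sum; apply: eq_bigr=> j _; rewrite !linearZ /= fg.
Qed.

Lemma tmapE U V U' V' (f : 'Hom(U, U')) (g : 'Hom(V, V')) u v :
  tmap f g (u ⊗ v) = f u ⊗ g v.
Proof.
apply: tliftE => [y a x x'|x a y y'] /=.
  by rewrite linearP tpure_linearl.
by rewrite linearP linearP.
Qed.

Lemma memv_tens U V (A : {vspace U}) (B : {vspace V}) u v :
  u \in A -> v \in B -> u ⊗ v \in tensv A B.
Proof.
move=> uA vB; rewrite (coord_vbasis uA) tpure_suml; apply: memv_suml => i _.
rewrite tpureZl memvZ // (coord_vbasis vB) linear_sum; apply: memv_suml => j _.
rewrite linearZ memvZ //=; apply: memv_span; apply/allpairsP.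
exists ((vbasis A)`_i, (vbasis B)`_j); split=> //=; apply: mem_nth.
  by rewrite size_tuple.
by rewrite size_tuple.
Qed.

End VectorSpaces.

Notation "u ⊗ v" := (tpure u v) : ring_scope.

Section Coalgebras.
Variable k : fieldType.

Record coalgebra (C : vectType k) := Coalgebra {
  comul : 'Hom(C, tens C C);
  counit : 'Hom(C, k^o);
  coassoc : forall x,
    tassoc C C C (tmap comul \1%VF (comul x)) = tmap \1%VF comul (comul x);
  counitl : forall x, tlift (fun y z => counit y *: z) (comul x) = x;
  counitr : forall x, tlift (fun y z => counit z *: y) (comul x) = x
}.

Section Filtration.
Variables (C : vectType k) (cC : coalgebra C).
Implicit Types D E N S : {vspace C}.

Definition subcoalg D : bool := (comul cC @: D <= tensv D D)%VS.

Definition simple_subcoalg D : Prop :=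
  [/\ subcoalg D, D != 0%VS
    & forall D', subcoalg D' -> (D' <= D)%VS -> D' = 0%VS \/ D' = D].

Definition coradical : {vspace C} := vsum simple_subcoalg.

Definition cosemisimple : Prop := coradical = fullv.

Fixpoint corad_filt (n : nat) : {vspace C} :=
  if n is n'.+1 then
    (comul cC @^-1: (tensv fullv (corad_filt n') + tensv coradical fullv))%VS
  else coradical.

Definition coalg_proj (p : 'End(C)) : Prop :=
  [/\ limg p = coradical,
      forall x, x \in coradical -> p x = x,
      forall x, comul cC (p x) = tmap p p (comul cC x)
    & forall x, counit cC (p x) = counit cC x].

Lemma coalg_proj_direct (p : 'End(C)) : coalg_proj p ->
  (coradical + lker p)%VS = fullv /\ (coradical :&: lker p)%VS = 0%VS.
Proof.
case=> img_p p_id _ _; split; apply/eqP.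
  rewrite eqEsubv subvf; apply/subvP=> x _.
  have px: p x \in coradical by rewrite -img_p memv_img ?memvf.
  rewrite -[x](subrKC (p x)) memv_add // memv_ker linearB /= (p_id (p x)) //.
  by rewrite subrr.
rewrite -subv0; apply/subvP=> x; rewrite memv_cap memv_ker => /andP[xC0 /eqP px].
by rewrite memv0 -(p_id x xC0) px.
Qed.

Lemma coalg_proj_coideal (p : 'End(C)) : coalg_proj p ->
  (comul cC @: lker p <= tensv (lker p) fullv + tensv fullv (lker p))%VS
  /\ (lker p <= lker (counit cC))%VS.
Proof.
case=> img_p p_id p_comul p_counit; split; last first.
  by apply/subvP=> x; rewrite !memv_ker -p_counit => /eqP->; rewrite linear0.
apply/subvP=> _ /memv_imgP[x xI ->]; set t := comul cC x.
have: tmap p p t = 0.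
  by move: xI; rewrite memv_ker -p_comul => /eqP->; rewrite linear0.
have ker1 y : y - p y \in lker p.
  by rewrite memv_ker linearB /= (p_id (p y)) ?subrr // -img_p memv_img ?memvf.
suff: t - tmap p p t \in (tensv (lker p) fullv + tensv fullv (lker p))%VS.
  by move=> + t0; rewrite t0 subr0.
rewrite [X in X - _](tpureE t) {2}(tpureE t) linear_sum -sumrB.
apply: memv_suml => i _; rewrite linear_sum -sumrB; apply: memv_suml => j _.
set u := _`_i; set v := _`_j; rewrite linearZ /= -scalerBr memvZ // tmapE.
have ->: u ⊗ v - p u ⊗ p v = (u - p u) ⊗ v + p u ⊗ (v - p v).
  apply/matrixP=> a b; rewrite !mxE !linearB /=.
  by rewrite mulrBl mulrBr addrA subrK.
by apply: memv_add; apply: memv_tens; rewrite ?memvf.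
Qed.

End Filtration.

Section Comodules.
Variables (C : vectType k) (cC : coalgebra C).
Implicit Types D E : {vspace C}.

Definition rcomod (V : vectType k) (rho : 'Hom(V, tens V C)) : Prop :=
  (forall v, tassoc V C C (tmap rho \1%VF (rho v)) = tmap \1%VF (comul cC) (rho v))
  /\ (forall v, tlift (fun w c => counit cC c *: w) (rho v) = v).

(* A right comodule over a subcoalgebra D is a right C-comodule whose coaction
   takes its values in V (x) D. *)
Definition simple_rcomod D (V : vectType k) (rho : 'Hom(V, tens V C)) : Prop :=
  [/\ rcomod rho, (limg rho <= tensv fullv D)%VS, fullv != 0%VS :> {vspace V}
    & forall X : {vspace V},
        (rho @: X <= tensv X fullv)%VS -> X = 0%VS \/ X = fullv].

(* The left coaction f |-> f_(-1) (x) f_(0) on the dual of a right comodule V,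
   characterized by f_(0)(v) f_(-1) = f(v_(0)) v_(1); it is the sum over a basis
   e_i of V, with dual basis e^i, of f((e_i)_(0)) (e_i)_(1) (x) e^i. *)
Definition dual_coact (V : vectType k) (rho : 'Hom(V, tens V C)) :
    'Hom(dual V, tens C (dual V)) :=
  linfun (fun f : 'Hom(V, k^o) =>
    \sum_(i < \dim {:V}) (tlift (fun w c => f w *: c) (rho (vbasis {:V})`_i) : C)
             ⊗ (linfun (coord (vbasis {:V}) i : V -> k^o) : dual V)).

Lemma dual_coactE (V : vectType k) (rho : 'Hom(V, tens V C)) (f : 'Hom(V, k^o)) v :
  tlift (fun c (g : 'Hom(V, k^o)) => g v *: c) (dual_coact rho f)
    = tlift (fun w c => f w *: c) (rho v).
Proof.
pose h (f : dual V) : tens C (dual V) :=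
  \sum_(i < \dim {:V}) (tlift (fun w c => (f : 'Hom(V, k^o)) w *: c) (rho (vbasis {:V})`_i) : C)
             ⊗ (linfun (coord (vbasis {:V}) i : V -> k^o) : dual V).
have h_lin : linear h.
  move=> a x y; rewrite /h scaler_sumr -big_split; apply: eq_bigr => i _ /=.
  rewrite -tpure_linearl; congr (_ ⊗ _); rewrite !tlift_def scaler_sumr -big_split.
  apply: eq_bigr => j _ /=; rewrite scaler_sumr -big_split; apply: eq_bigr => l _ /=.
  rewrite !lfunE /= lfunE /= scalerDl scalerDr !scalerA; congr (_ *: _ + _).
  by rewrite -mulrA mulrCA.
pose hL := GRing.isLinear.Build k (dual V) (tens C (dual V)) _ h h_lin.
pose h' : {linear dual V -> tens C (dual V)} := HB.pack h hL.
have ->: dual_coact rho f = h f by exact: (lfunE h' f).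
rewrite /h linear_sum {2}(coord_vbasis (memvf v)) !linear_sum /=.
apply: eq_bigr => i _; rewrite tliftE /= ?lfunE ?linearZ //.
  by move=> y a x x'; rewrite scalerDr !scalerA mulrC.
by move=> x a g g'; rewrite !lfunE /= lfunE /= scalerDl scalerA.
Qed.

(* The coactions on U (x) W of a left comodule U and a right comodule W. *)
Definition tens_lcoact (U W : vectType k) (lam : 'Hom(U, tens C U)) :
    'Hom(tens U W, tens C (tens U W)) :=
  (tassoc C U W \o tmap lam \1)%VF.

Definition tens_rcoact (U W : vectType k) (rho : 'Hom(W, tens W C)) :
    'Hom(tens U W, tens (tens U W) C) :=
  (tassoc_inv U W C \o tmap \1 rho)%VF.

End Comodules.

Section Blocks.
Variables (C : vectType k) (cC : coalgebra C).

Section Bicomodule.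
Variable p : 'End(C).
Implicit Types D E N S Q : {vspace C}.

Definition rhoL : 'Hom(C, tens C C) := (tmap p \1 \o comul cC)%VF.
Definition rhoR : 'Hom(C, tens C C) := (tmap \1 p \o comul cC)%VF.

Definition subbicomod N : bool :=
  (rhoL @: N <= tensv (coradical cC) N)%VS
  && (rhoR @: N <= tensv N (coradical cC))%VS.

Definition simple_subbicomod S : Prop :=
  [/\ subbicomod S, S != 0%VS
    & forall N, subbicomod N -> (N <= S)%VS -> N = 0%VS \/ N = S].

(* S is isomorphic, as a bicomodule, to the tensor product of the dual of a
   simple right D-comodule V and a simple right E-comodule W. *)
Definition of_type D E S : Prop :=
  exists (V W : vectType k) (rV : 'Hom(V, tens V C)) (rW : 'Hom(W, tens W C))
         (f : 'Hom(tens (dual V) W, C)),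
  [/\ simple_rcomod cC D rV, simple_rcomod cC E rW,
      lker f = 0%VS /\ limg f = S,
      forall x, rhoL (f x) = tmap \1%VF f (tens_lcoact W (dual_coact rV) x)
    & forall x, rhoR (f x) = tmap f \1%VF (tens_rcoact (dual V) rW x)].

(* Q^{tau,mu}, where D = D_tau and E = D_mu. *)
Definition isotypic Q D E : {vspace C} :=
  vsum (fun S => [/\ simple_subbicomod S, (S <= Q)%VS & of_type D E S]).

Definition filt_ker (n : nat) : {vspace C} := (corad_filt cC n :&: lker p)%VS.

End Bicomodule.

(* Simple subcoalgebras serve as their own indices; d_tau is given by
   d_tau ^ 2 = dim D_tau. The value of [bs_Q] at 0 is irrelevant. *)
Record block_system := BlockSystem {
  bs_proj : 'End(C);
  bs_projP : coalg_proj cC bs_proj;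
  bs_Q : nat -> {vspace C};
  bs_Q_sub : forall n, subbicomod bs_proj (bs_Q n.+1);
  bs_Q_add : forall n,
    (filt_ker bs_proj n + bs_Q n.+1)%VS = filt_ker bs_proj n.+1;
  bs_Q_cap : forall n, (filt_ker bs_proj n :&: bs_Q n.+1)%VS = 0%VS
}.

Definition block (B : block_system) (n d1 d2 : nat) : {vspace C} :=
  if n is 0%N then
    if d1 == d2
    then vsum (fun D => simple_subcoalg cC D /\ \dim D = (d1 ^ 2)%N)
    else 0%VS
  else
    vsum (fun X => exists D E,
      [/\ simple_subcoalg cC D /\ \dim D = (d1 ^ 2)%N,
          simple_subcoalg cC E /\ \dim E = (d2 ^ 2)%N
        & X = isotypic (bs_proj B) (bs_Q B n) D E]).

End Blocks.

Definition tens_mul (H : falgType k) (s t : tens H H) : tens H H :=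
  tlift (fun a b => tlift (fun c d => (a * c) ⊗ (b * d)) t) s.

Record hopf_algebra (H : falgType k) := HopfAlgebra {
  hopf_coalg :> coalgebra H;
  comulM : forall x y,
    comul hopf_coalg (x * y) = tens_mul (comul hopf_coalg x) (comul hopf_coalg y);
  comul1 : comul hopf_coalg 1 = 1 ⊗ 1;
  counitM : forall x y,
    counit hopf_coalg (x * y) = counit hopf_coalg x * counit hopf_coalg y;
  counit1 : counit hopf_coalg 1 = 1;
  antipode : 'End(H);
  antipodel : forall x,
    tlift (fun y z => antipode y * z) (comul hopf_coalg x)
      = counit hopf_coalg x *: 1;
  antipoder : forall x,
    tlift (fun y z => y * antipode z) (comul hopf_coalg x)
      = counit hopf_coalg x *: 1
}.

End Coalgebras.

(* Main.v *)
From HB Require Import structures.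
Require Import Defs.
From mathcomp Require Import all_boot all_order all_algebra all_field.
From mathcomp Require Import boolp.

Set Implicit Arguments.
Unset Strict Implicit.
Unset Printing Implicit Defensive.

Import GRing.Theory.
Local Open Scope ring_scope.

(** Let C be the coalgebra underlying H.  Everything is read in the dual algebra
    A = C^* with its convolution product.  The annihilator J of the coradical is an ideal, the annihilator of the n-th
    term of the coradical filtration is J^(n+1) ([corad_filtD]), and A/J is a
    product of matrix algebras, one factor of dimension d^2 for each simple
    subcoalgebra D ([simple_comatrix], which rests on Burnside's theorem).  If
    e_D in A lifts the central idempotent of the factor D, then the block
    B_n^(d1,d2), with n > 0, is nonzero exactly when e_D J^n e_E is not contained
    in J^(n+1) for some D, E of dimensions d1^2, d2^2 ([block_link]).  The lift
    may be changed by an element of J ([link_indep]), so that this condition no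
    longer sees the projection and the complements chosen in the block system.

    Splitting.  J^n = J^i J^(n-i), and 1 is the sum of the e_F modulo J; hence if
    e_D J^n e_E is not in J^(n+1), then e_D J^i e_F J^(n-i) e_E is not either for
    some F, and both halves are nonzero ([link_split]).

    Symmetry.  The antipode of a finite-dimensional Hopf algebra is a bijective
    anti-homomorphism of coalgebras.  Its transpose therefore preserves the
    powers of J, permutes the simple components without changing dimensions,
    and exchanges left and right ([link_antihom]).

    No maximal layer off the diagonal.  If no block with first index d1 lies
    further out than n, then e_D J^(n+1) = 0 since J is nilpotent ([link_vanish]),
    so e_D J^n lies in the right socle of A.  For a Hopf algebra, A is a Frobenius
    algebra: evaluation at a nonzero left integral t of H is a nondegenerate
    form ([left_integral_ex], [left_integral_nondeg]).  The Nakayama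
    automorphism of this form sends e_D to an idempotent that lifts a simple
    component of the same dimension, and that component is the only E for which
    e_D J^n e_E can be nonzero in the socle ([frobenius_socle]).  Hence d1 = d2. *)

(** * Functionals, tensors and subspaces *)

Section Functionals.
Variable k : fieldType.
Implicit Types U V W : vectType k.

Definition ann U (X : {vspace U}) (f : 'Hom(U, k^o)) : Prop :=
  forall x, x \in X -> f x = 0.

Lemma ann_sep U (X : {vspace U}) x :
  (forall f, ann X f -> f x = 0) -> x \in X.
Proof.
move=> Xx; suff: x - projv X x = 0 by move/eqP; rewrite subr_eq0 => /eqP->; rewrite memv_proj.
set y := x - _; rewrite (coord_vbasis (memvf y)); apply: big1 => i _.
pose c : 'Hom(U, k^o) := linfun (coord (vbasis {:U}) i : U -> k^o).
pose f : 'Hom(U, k^o) := (c \o (\1 - projv X))%VF.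
have fE z : f z = coord (vbasis {:U}) i (z - projv X z).
  by rewrite /f comp_lfunE lfunE /= !lfunE /= !lfunE.
suff: f x = 0 by rewrite fE => ->; rewrite scale0r.
by apply: Xx => z zX; rewrite fE projv_id // subrr linear0.
Qed.

Lemma functional_sep U (x y : U) : (forall f : 'Hom(U, k^o), f x = f y) -> x = y.
Proof.
move=> fxy; apply/eqP; rewrite -subr_eq0 -memv0; apply: ann_sep => f _.
by rewrite linearB /= fxy subrr.
Qed.

Lemma linear_lfun (U V : vectType k) (F : U -> V) : linear F ->
  exists G : 'Hom(U, V), forall u, G u = F u.
Proof.
move=> F_lin; pose FL := GRing.isLinear.Build k U V _ F F_lin.
pose F' : {linear U -> V} := HB.pack F FL.
by exists (linfun F') => u; rewrite lfunE.
Qed.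

Lemma linear_image (U V : vectType k) (F : U -> V) : linear F ->
  exists X : {vspace V}, forall x, (x \in X) <-> exists u, x = F u.
Proof.
move=> /linear_lfun[G GE]; exists (limg G) => x.
split=> [/memv_imgP[u _ ->]|[u ->]]; first by exists u; rewrite GE.
by apply/memv_imgP; exists u; rewrite ?memvf ?GE.
Qed.

Definition tpair U V (f : 'Hom(U, k^o)) (g : 'Hom(V, k^o)) : 'Hom(tens U V, k^o) :=
  tlift (fun u v => f u * g v : k^o).

Lemma tpair_pure U V (f : 'Hom(U, k^o)) (g : 'Hom(V, k^o)) u v :
  tpair f g (u ⊗ v) = f u * g v.
Proof.
apply: tliftE => [y a x x'|x a y y'].
  by rewrite linearP /= mulrDl -mulrA.
by rewrite linearP /= mulrDr mulrCA.
Qed.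

Lemma tens_coord U V (r : tens U V) i j :
  (r : 'M[k]_(\dim {:U}, \dim {:V})) i j =
  tpair (linfun (coord (vbasis {:U}) i : U -> k^o))
        (linfun (coord (vbasis {:V}) j : V -> k^o)) r.
Proof.
have frU := basis_free (vbasisP {:U}); have frV := basis_free (vbasisP {:V}).
rewrite [tpair _ _ _]tlift_def (bigD1 i) //= (bigD1 j) //= !lfunE /= !coord_free //.
rewrite !eqxx mulr1 -[LHS]mulr1 !big1 ?addr0 //.
  move=> i' ni; rewrite big1 // => j' _.
  by rewrite !lfunE /= !coord_free // (negPf ni) mul0r scaler0.
by move=> j' nj; rewrite !lfunE /= !coord_free // (negPf nj) mulr0 scaler0.
Qed.

Lemma tens_sep U V (s t : tens U V) :
  (forall f g, tpair f g s = tpair f g t) -> s = t.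
Proof. by move=> st; apply/matrixP=> i j; rewrite !tens_coord st. Qed.

Lemma tens_eq U V W (F G : {linear tens U V -> W}) :
  (forall u v, F (u ⊗ v) = G (u ⊗ v)) -> F =1 G.
Proof.
move=> FG t; rewrite (tpureE t) !linear_sum; apply: eq_bigr => i _ /=.
by rewrite !linear_sum; apply: eq_bigr=> j _ /=; rewrite !linearZ /= FG.
Qed.

Definition slicel U V (f : 'Hom(U, k^o)) : 'Hom(tens U V, V) :=
  tlift (fun u v => f u *: v).
Definition slicer U V (g : 'Hom(V, k^o)) : 'Hom(tens U V, U) :=
  tlift (fun u v => g v *: u).

Lemma slicel_pure U V (f : 'Hom(U, k^o)) u v : slicel V f (u ⊗ v) = f u *: v.
Proof.
apply: tliftE => [y a x x'|x a y y'].
  by rewrite linearP /= scalerDl scalerA.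
by rewrite scalerDr !scalerA mulrC.
Qed.

Lemma slicer_pure U V (g : 'Hom(V, k^o)) u v : slicer U g (u ⊗ v) = g v *: u.
Proof.
apply: tliftE => [y a x x'|x a y y'].
  by rewrite scalerDr !scalerA mulrC.
by rewrite linearP /= scalerDl scalerA.
Qed.

Lemma tpair_slicel U V (f : 'Hom(U, k^o)) (g : 'Hom(V, k^o)) t :
  tpair f g t = g (slicel V f t).
Proof.
rewrite -[RHS]comp_lfunE; apply: tens_eq => u v.
by rewrite /= comp_lfunE tpair_pure slicel_pure linearZ.
Qed.

Lemma tpair_slicer U V (f : 'Hom(U, k^o)) (g : 'Hom(V, k^o)) t :
  tpair f g t = f (slicer U g t).
Proof.
rewrite -[RHS]comp_lfunE; apply: tens_eq => u v.
by rewrite /= comp_lfunE tpair_pure slicer_pure linearZ /= mulrC.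
Qed.

Lemma tpairBl U V (f f' : 'Hom(U, k^o)) (g : 'Hom(V, k^o)) t :
  tpair (f - f') g t = tpair f g t - tpair f' g t.
Proof. by rewrite !tpair_slicer add_lfunE opp_lfunE. Qed.

Lemma tpairBr U V (f : 'Hom(U, k^o)) (g g' : 'Hom(V, k^o)) t :
  tpair f (g - g') t = tpair f g t - tpair f g' t.
Proof. by rewrite !tpair_slicel add_lfunE opp_lfunE. Qed.

Lemma tpair_tmap U V U' V' (p : 'Hom(U, U')) (q : 'Hom(V, V')) f g t :
  tpair f g (tmap p q t) = tpair (f \o p)%VF (g \o q)%VF t.
Proof.
rewrite -[LHS]comp_lfunE; apply: tens_eq => u v.
by rewrite /= comp_lfunE tmapE !tpair_pure !comp_lfunE.
Qed.

Lemma tmap_tensv U V U' V' (p : 'Hom(U, U')) (q : 'Hom(V, V')) A B t :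
  (limg p <= A)%VS -> (limg q <= B)%VS -> tmap p q t \in tensv A B.
Proof.
move=> /subvP pA /subvP qB; rewrite (tpureE t) linear_sum; apply: memv_suml => i _.
rewrite linear_sum; apply: memv_suml => j _; rewrite linearZ memvZ //= tmapE.
by apply: memv_tens; [apply: pA | apply: qB]; rewrite memv_img ?memvf.
Qed.

Lemma slicel_tensv U V (A : {vspace U}) (B : {vspace V}) f t :
  t \in tensv A B -> slicel V f t \in B.
Proof.
move=> tAB; have: slicel V f t \in (slicel V f @: tensv A B)%VS by rewrite memv_img.
apply/subvP; rewrite limg_span; apply/span_subvP => _ /mapP[_ /allpairsP[[u v] [/= _ vB ->]] ->].
by rewrite slicel_pure memvZ // vbasis_mem.
Qed.

Lemma slicer_tensv U V (A : {vspace U}) (B : {vspace V}) f t :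
  t \in tensv A B -> slicer U f t \in A.
Proof.
move=> tAB; have: slicer U f t \in (slicer U f @: tensv A B)%VS by rewrite memv_img.
apply/subvP; rewrite limg_span; apply/span_subvP => _ /mapP[_ /allpairsP[[u v] [/= uA _ ->]] ->].
by rewrite slicer_pure memvZ // vbasis_mem.
Qed.

(** When the slices lie in A and B, the tensor is fixed by the product of the
    projections onto A and B, as functionals cannot tell the two apart. *)
Lemma mem_tensv U V (A : {vspace U}) (B : {vspace V}) t :
  (forall f, slicel V f t \in B) -> (forall g, slicer U g t \in A) ->
  t \in tensv A B.
Proof.
move=> tB tA; suff <-: tmap (projv A) (projv B) t = t.
  by apply: tmap_tensv; rewrite limg_proj.
apply: tens_sep => f g; rewrite tpair_tmap tpair_slicel comp_lfunE projv_id //.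
by rewrite -tpair_slicel tpair_slicer comp_lfunE projv_id // -tpair_slicer.
Qed.

(** This turns the wedge that defines the coradical filtration into a condition
    on functionals, that is into a product of ideals of the dual algebra. *)
Lemma mem_tensv_add U V (A : {vspace U}) (B : {vspace V}) t :
  (t \in (tensv fullv B + tensv A fullv)%VS) <->
  (forall f g, ann A f -> ann B g -> tpair f g t = 0).
Proof.
split=> [/memv_addP[s sB [r rA ->]] f g fA gB | t0].
  rewrite linearD /= tpair_slicel gB ?(slicel_tensv _ sB) // add0r.
  by rewrite tpair_slicer fA // (slicer_tensv _ rA).
set p := projv A; set q := projv B.
have: tmap (\1 - p)%VF (\1 - q)%VF t = 0.
  apply: tens_sep => f g; rewrite linear0 tpair_tmap; apply: t0 => x xX.
    by rewrite comp_lfunE add_lfunE opp_lfunE id_lfunE projv_id // subrr linear0.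
  by rewrite comp_lfunE add_lfunE opp_lfunE id_lfunE projv_id // subrr linear0.
suff ->: tmap (\1 - p)%VF (\1 - q)%VF t = t - (tmap \1%VF q t + tmap p (\1 - q)%VF t).
  move/eqP; rewrite subr_eq0 => /eqP->; apply: memv_add.
    by apply: tmap_tensv; rewrite ?subvf ?limg_proj.
  by apply: tmap_tensv; rewrite ?subvf ?limg_proj.
apply: tens_sep => f g; rewrite linearB linearD /= !tpair_tmap.
rewrite !comp_lfunDr !comp_lfunNr !comp_lfun1r !tpairBl !tpairBr.
by rewrite [in RHS]opprD [in RHS]addrA.
Qed.

Lemma tassoc_pure (U V W : vectType k) (u : U) (v : V) (w : W) :
  tassoc U V W ((u ⊗ v) ⊗ w) = u ⊗ (v ⊗ w).
Proof.
rewrite [tassoc U V W]/tassoc tliftE ?tliftE // => [z a x y|y a x x'|x a y y'|s a x y].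
- by rewrite tpure_linearl.
- by rewrite tpure_linearl linearP.
- by rewrite linearP.
rewrite !tlift_def scaler_sumr -big_split; apply: eq_bigr => i _ /=.
rewrite scaler_sumr -big_split; apply: eq_bigr => j _ /=.
by rewrite !linearP.
Qed.

Lemma tens3_eq (U V W Z : vectType k) (F G : {linear tens (tens U V) W -> Z}) :
  (forall u v w, F ((u ⊗ v) ⊗ w) = G ((u ⊗ v) ⊗ w)) -> F =1 G.
Proof.
move=> FG; apply: tens_eq => s w; rewrite (tpureE s) tpure_suml !linear_sum.
apply: eq_bigr => i _ /=; rewrite tpure_suml !linear_sum; apply: eq_bigr => j _ /=.
by rewrite tpureZl !linearZ /= FG.
Qed.

Lemma tpair_tassoc (U V W : vectType k) (f : 'Hom(U, k^o)) (g : 'Hom(V, k^o))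
    (h : 'Hom(W, k^o)) t :
  tpair f (tpair g h) (tassoc U V W t) = tpair (tpair f g) h t.
Proof.
rewrite -[LHS]comp_lfunE; apply: tens3_eq => u v w.
by rewrite /= comp_lfunE tassoc_pure !tpair_pure mulrA.
Qed.

Lemma tpair_sum (U W : vectType k) (I : Type) (r : seq I) (f : 'Hom(U, k^o))
    (g : 'Hom(W, k^o)) a b :
  tpair f g (\sum_(i <- r) a i ⊗ b i) = \sum_(i <- r) f (a i) * g (b i).
Proof. by rewrite linear_sum; apply: eq_bigr => i _ /=; rewrite tpair_pure. Qed.

Lemma tens_sum_sep (U W Z : vectType k) (I : Type) (r : seq I) (a : I -> U) (b : I -> W) t :
    (forall f g, tpair f g t = \sum_(i <- r) f (a i) * g (b i)) ->
  forall L : 'Hom(tens U W, Z), L t = \sum_(i <- r) L (a i ⊗ b i).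
Proof.
move=> tE L; rewrite -linear_sum; congr (L _); apply: tens_sep => f g.
by rewrite tpair_sum tE.
Qed.

Lemma tassoc_inv_pure U V W (u : U) (v : V) (w : W) :
  tassoc_inv U V W (u ⊗ (v ⊗ w)) = (u ⊗ v) ⊗ w.
Proof.
rewrite [tassoc_inv U V W]/tassoc_inv tliftE => [|s a x y|x a s s']; last by rewrite linearP.
  rewrite tliftE // => [y a x x'|x a y y']; last by rewrite linearP.
  by rewrite linearP tpure_linearl.
rewrite !tlift_def scaler_sumr -big_split; apply: eq_bigr => i _ /=.
rewrite scaler_sumr -big_split; apply: eq_bigr => j _ /=.
by rewrite !tpure_linearl scalerDr !scalerA mulrC.
Qed.

Lemma tensv_map U V W (F : {linear tens U V -> W}) (A : {vspace U})
    (B : {vspace V}) (X : {vspace W}) s :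
  (forall u v, u \in A -> v \in B -> F (u ⊗ v) \in X) -> s \in tensv A B -> F s \in X.
Proof.
move=> FX; have [G GE] := linear_lfun (linearP F : linear F).
rewrite -GE => sAB; have: G s \in (G @: tensv A B)%VS by rewrite memv_img.
apply/subvP; rewrite limg_span; apply/span_subvP => _ /mapP[_ /allpairsP[[u v] [/= uA vB ->]] ->].
by rewrite GE FX ?vbasis_mem.
Qed.

(** Reflexivity in finite dimension, used to test tensors with a factor V^*. *)
Lemma dual_eval V (F : 'Hom(dual V, k^o)) :
  exists v, forall g : 'Hom(V, k^o), F g = g v.
Proof.
pose co i : 'Hom(V, k^o) := linfun (coord (vbasis {:V}) i : V -> k^o).
exists (\sum_(i < \dim {:V}) F (co i) *: (vbasis {:V})`_i) => g.
have gE : g = \sum_(i < \dim {:V}) g (vbasis {:V})`_i *: co i.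
  apply/lfunP => x; rewrite {1}(coord_vbasis (memvf x)) linear_sum sum_lfunE.
  by apply: eq_bigr => i _; rewrite linearZ scale_lfunE lfunE /= [LHS]mulrC.
rewrite {1}gE !linear_sum; apply: eq_bigr => i _.
by rewrite !linearZ /= [LHS]mulrC.
Qed.

Lemma vsum_nz V (P : {vspace V} -> Prop) : vsum P != 0%VS -> exists2 A, P A & A != 0%VS.
Proof.
have [_ [s sP ->]] := vsumP P; move=> nz; apply: contrapT => no; case/negP: nz.
apply/eqP; rewrite big_seq big1 // => A As; apply/eqP; apply: contrapT => /negP nzA.
by apply: no; exists A => //; apply: sP.
Qed.

Lemma vsum_sup V (P : {vspace V} -> Prop) A : P A -> A != 0%VS -> vsum P != 0%VS.
Proof.
have [H _] := vsumP P; move=> /H sub; apply: contraNneq => v0.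
by rewrite -subv0 -v0.
Qed.

Lemma min_vspace U (P : {vspace U} -> Prop) X : P X ->
  exists2 X0, P X0 /\ (X0 <= X)%VS & forall X', P X' -> (X' <= X0)%VS -> X' = X0.
Proof.
elim: {X}(\dim X) {-2}X (leqnn (\dim X)) => [|n IHn] X dX PX.
  exists X => // X' _ X'X; apply/eqP; rewrite eqEdim X'X.
  by rewrite (leq_trans dX).
have [minX|] := pselect (forall X', P X' -> (X' <= X)%VS -> X' = X); first by exists X.
move=> /existsNP[X' /not_implyP[PX' /not_implyP[X'X nX']]].
have [] := IHn X' _ PX'.
  rewrite -ltnS (leq_trans _ dX) // ltnNge; apply/negP => dXX'; apply: nX'.
  by apply/eqP; rewrite eqEdim X'X.
by move=> X0 [PX0 X0V'] minX0; exists X0 => //; split=> //; apply: subv_trans X'X.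
Qed.

Lemma dual_bases_ex d : exists (V : vectType k) (u : 'I_d -> V)
    (co : 'I_d -> 'Hom(V, k^o)),
  (forall v, v = \sum_j co j v *: u j) /\ (forall i j, co i (u j) = (i == j)%:R).
Proof.
have /choice[co coE] (i : 'I_d) : exists co : 'Hom('rV[k]_d, k^o), forall v, co v = v 0 i.
  by apply: linear_lfun => a v w; rewrite !mxE.
exists 'rV[k]_d, (fun i => delta_mx 0 i), co; split=> [v|i j].
  by rewrite {1}(row_sum_delta v); apply: eq_bigr => j _; rewrite coE.
by rewrite coE mxE.
Qed.

End Functionals.

(** * Convolution and the coradical filtration *)

Section Convolution.
Variables (k : fieldType) (C : vectType k) (cC : coalgebra C).
Implicit Types (f g h : 'Hom(C, k^o)) (x y : C) (D E X : {vspace C}).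

(** The actions f(x_1) x_2 and x_1 f(x_2) of C^* on C; they are the transposes of
    the multiplications by f, see [lhE] and [rhE]. *)
Definition lh f : 'End(C) := (slicel C f \o comul cC)%VF.
Definition rh f : 'End(C) := (slicer C f \o comul cC)%VF.
Definition conv f g : 'Hom(C, k^o) := (tpair f g \o comul cC)%VF.

Local Infix "**" := conv (at level 40, left associativity).
Local Notation eps := (counit cC).

Lemma convE f g x : (f ** g) x = tpair f g (comul cC x).
Proof. exact: comp_lfunE. Qed.

Lemma lhE f g x : g (lh f x) = (f ** g) x.
Proof. by rewrite convE tpair_slicel comp_lfunE. Qed.

Lemma rhE f g x : f (rh g x) = (f ** g) x.
Proof. by rewrite convE tpair_slicer comp_lfunE. Qed.

Lemma convA f g h : f ** (g ** h) = f ** g ** h.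
Proof.
apply/lfunP => x; rewrite !convE -[f]comp_lfun1r -tpair_tmap -coassoc.
by rewrite tpair_tassoc tpair_tmap !comp_lfun1r.
Qed.

Lemma lh1 x : lh eps x = x.
Proof. by rewrite comp_lfunE; exact: counitl. Qed.

Lemma rh1 x : rh eps x = x.
Proof. by rewrite comp_lfunE; exact: counitr. Qed.

Lemma conv1l f : eps ** f = f.
Proof. by apply/lfunP => x; rewrite -lhE lh1. Qed.

Lemma conv1r f : f ** eps = f.
Proof. by apply/lfunP => x; rewrite -rhE rh1. Qed.

Lemma convBl f f' g : (f - f') ** g = f ** g - f' ** g.
Proof. by apply/lfunP=> x; rewrite !(add_lfunE, opp_lfunE) -!rhE !(add_lfunE, opp_lfunE). Qed.

Lemma convBr f g g' : f ** (g - g') = f ** g - f ** g'.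
Proof. by apply/lfunP=> x; rewrite !(add_lfunE, opp_lfunE) -!lhE !(add_lfunE, opp_lfunE). Qed.

Lemma convZl a f g : (a *: f) ** g = a *: (f ** g).
Proof. by apply/lfunP=> x; rewrite scale_lfunE -!rhE scale_lfunE. Qed.

Lemma convZr a f g : f ** (a *: g) = a *: (f ** g).
Proof. by apply/lfunP=> x; rewrite scale_lfunE -!lhE scale_lfunE. Qed.

Lemma conv_suml (I : Type) (r : seq I) (F : I -> 'Hom(C, k^o)) g :
  (\sum_(i <- r) F i) ** g = \sum_(i <- r) F i ** g.
Proof.
apply/lfunP=> x; rewrite -rhE !sum_lfunE; apply: eq_bigr => i _; exact: rhE.
Qed.

Lemma conv_sumr (I : Type) (r : seq I) (F : I -> 'Hom(C, k^o)) g :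
  g ** (\sum_(i <- r) F i) = \sum_(i <- r) g ** F i.
Proof.
apply/lfunP=> x; rewrite -lhE !sum_lfunE; apply: eq_bigr => i _; exact: lhE.
Qed.

Definition coalg_hom (th : 'End(C)) : Prop :=
  forall f g, ((f ** g) \o th = (f \o th) ** (g \o th))%VF.
Definition coalg_antihom (th : 'End(C)) : Prop :=
  forall f g, ((f ** g) \o th = (g \o th) ** (f \o th))%VF.

Lemma lh_lh f g x : lh f (lh g x) = lh (g ** f) x.
Proof. by apply: functional_sep => h; rewrite !lhE convA. Qed.

Lemma rh_rh f g x : rh f (rh g x) = rh (f ** g) x.
Proof. by apply: functional_sep => h; rewrite !rhE convA. Qed.

Lemma subcoalgP D :
  subcoalg cC D <->
  (forall f x, x \in D -> lh f x \in D) /\ (forall f x, x \in D -> rh f x \in D).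
Proof.
split=> [/subvP cD | [Dl Dr]].
  split=> f x xD; rewrite comp_lfunE.
    by apply: slicel_tensv (cD _ (memv_img _ xD)).
  by apply: slicer_tensv (cD _ (memv_img _ xD)).
apply/subvP => _ /memv_imgP[x xD ->].
apply: mem_tensv => f; first by rewrite -[X in X \in _]comp_lfunE; apply: Dl.
by rewrite -[X in X \in _]comp_lfunE; apply: Dr.
Qed.

Lemma ann_convl D f g : subcoalg cC D -> ann D f -> ann D (f ** g).
Proof. by case/subcoalgP=> _ Dr Df x /(Dr g) /Df; rewrite rhE. Qed.

Lemma ann_convr D f g : subcoalg cC D -> ann D f -> ann D (g ** f).
Proof. by case/subcoalgP=> Dl _ Df x /(Dl g) /Df; rewrite lhE. Qed.

(** Subcoalgebras correspond to the two-sided ideals of the dual algebra. *)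
Lemma subcoalg_ann D :
    (forall f g, ann D f -> ann D (f ** g)) ->
    (forall f g, ann D f -> ann D (g ** f)) -> subcoalg cC D.
Proof.
move=> Dr Dl; apply/subcoalgP; split=> g x xD; apply: ann_sep => f Df.
  by rewrite lhE; apply: Dl xD.
by rewrite rhE; apply: Dr xD.
Qed.

Lemma ann_sub X f g : ann X (f - g) -> forall x, x \in X -> f x = g x.
Proof. by move=> X0 x /X0; rewrite add_lfunE opp_lfunE => /eqP; rewrite subr_eq0 => /eqP. Qed.

Lemma annS X Y f : (X <= Y)%VS -> ann Y f -> ann X f.
Proof. by move=> /subvP XY Yf x /XY /Yf. Qed.

Lemma subcoalg_sum (s : seq {vspace C}) :
  (forall D, D \in s -> subcoalg cC D) -> subcoalg cC (\sum_(D <- s) D)%VS.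
Proof.
elim: s => [|D s IHs] sP.
  rewrite big_nil; apply: subcoalg_ann => f g _ x; rewrite memv0 => /eqP->; exact: linear0.
have cD : subcoalg cC D by apply: sP; rewrite mem_head.
have /IHs cs : forall E, E \in s -> subcoalg cC E by move=> E Es; rewrite sP // inE Es orbT.
rewrite big_cons; apply: subcoalg_ann => f g Xf _ /memv_addP[x xD [y ys ->]]; rewrite linearD /=.
  rewrite (ann_convl _ cD (annS (addvSl _ _) Xf) xD).
  by rewrite (ann_convl _ cs (annS (addvSr _ _) Xf) ys) addr0.
rewrite (ann_convr _ cD (annS (addvSl _ _) Xf) xD).
by rewrite (ann_convr _ cs (annS (addvSr _ _) Xf) ys) addr0.
Qed.

Local Notation C0 := (coradical cC).
Local Notation CF := (corad_filt cC).

Lemma simple_sub_coradical D : simple_subcoalg cC D -> (D <= C0)%VS.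
Proof. by have [H _] := vsumP (simple_subcoalg cC); apply: H. Qed.

Lemma subcoalg_coradical : subcoalg cC C0.
Proof.
have [_ [s sP]] := vsumP (simple_subcoalg cC); rewrite -/C0 => ->.
by apply: subcoalg_sum => D /sP[].
Qed.

Lemma corad_filtS n x :
  x \in CF n.+1 <-> (forall f g, ann C0 f -> ann (CF n) g -> (f ** g) x = 0).
Proof.
rewrite /= -memv_preim; split=> [/mem_tensv_add H f g fA gB | H].
  by rewrite convE H.
by apply/mem_tensv_add => f g fA gB; rewrite -convE H.
Qed.

Lemma subcoalg_corad_filt n : subcoalg cC (CF n).
Proof.
elim: n => [|n IHn]; first exact: subcoalg_coradical.
apply/subcoalgP; split=> h x /corad_filtS xC; apply/corad_filtS => f g fA gB.
  rewrite lhE convA; apply: xC => //; exact: ann_convr subcoalg_coradical fA.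
rewrite rhE -convA; apply: xC => //; exact: ann_convl IHn gB.
Qed.

Lemma corad_filt_incr n : (CF n <= CF n.+1)%VS.
Proof.
apply/subvP => x xC; apply/corad_filtS => f g _ gB.
exact: ann_convr (subcoalg_corad_filt n) gB _ xC.
Qed.

Lemma corad_filt_mono m n : (m <= n)%N -> (CF m <= CF n)%VS.
Proof.
elim: n => [|n IHn]; first by rewrite leqn0 => /eqP->.
by rewrite leq_eqVlt => /predU1P[-> // | /IHn /subv_trans]; apply; apply: corad_filt_incr.
Qed.

(** With J the annihilator of the coradical, this says J^(a+1) J^(b+1) = J^(a+b+2).
    The definition is the case a = 0; the induction moves one factor of J to the
    left through associativity. *)
Lemma corad_filtD a b x :
  x \in CF (a + b).+1 <->
  (forall f g, ann (CF a) f -> ann (CF b) g -> (f ** g) x = 0).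
Proof.
elim: a b x => [|a IHa] b x; first exact: corad_filtS.
rewrite addSn corad_filtS; split=> H f g fA gB.
  rewrite -rhE; apply: (fA); apply/corad_filtS => f1 f2 f1A f2A.
  rewrite rhE -convA; apply: H => // y /IHa; exact.
rewrite -lhE; apply: gB; apply/IHa => f1 f2 f1A f2A.
rewrite lhE convA; apply: H => // y /corad_filtS; exact.
Qed.

End Convolution.

(** * Burnside's theorem *)

Section Burnside.
Variable k : closedFieldType.

Lemma closed_eigenvalue r (M : 'M[k]_r) : (0 < r)%N -> exists a, (\rank (M - a%:M)%R < r)%N.
Proof.
move=> r_gt0; have /closed_rootP[a] : size (char_poly M) != 1%N.
  by rewrite size_char_poly eqSS -lt0n.
rewrite -eigenvalue_root_char => Ma; exists a; move: Ma.
rewrite /eigenvalue /eigenspace kermx_eq0 /row_free ltn_neqAle => ->.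
exact: rank_leq_row.
Qed.

Variables (d : nat) (X : {vspace 'M[k]_d}).
Hypothesis d_gt0 : (0 < d)%N.
Hypothesis XM : forall A B, A \in X -> B \in X -> A *m B \in X.
Hypothesis X_trans : forall u v : 'cV[k]_d, u != 0 -> exists2 A, A \in X & A *m u = v.

(** The argument of Lomonosov and Rosenthal.  If A has rank r > 1, write A = L R
    with r columns in L; some B makes R B L non-scalar, and for an eigenvalue a of
    R B L the matrix A B A - a A = L (R B L - a) R is nonzero of smaller rank. *)
Lemma burnside_rank1 : exists2 A, A \in X & \rank A = 1%N.
Proof.
have [A AX nzA] : exists2 A, A \in X & A != 0.
  pose e : 'cV[k]_d := const_mx 1.
  have nze : e != 0.
    apply/eqP=> /matrixP/(_ (Ordinal d_gt0) 0); rewrite !mxE => /eqP.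
    by rewrite oner_eq0.
  have [A AX Ae] := X_trans e nze; exists A => //.
  by apply: contraNneq nze => A0; rewrite -Ae A0 mul0mx.
elim: {A}(\rank A) {-2}A (leqnn (\rank A)) AX nzA => [|n IHn] A.
  by rewrite leqn0 mxrank_eq0 => /eqP->; rewrite eqxx.
move=> rA AX nzA; have [r1|r_neq1] := eqVneq (\rank A) 1%N; first by exists A.
have r_gt1 : (1 < \rank A)%N by rewrite ltn_neqAle eq_sym r_neq1 lt0n mxrank_eq0.
have r_gt0 := ltnW r_gt1.
have [L [R [A_LR fL fR]]] : exists (L : 'M_(d, \rank A)) (R : 'M_(\rank A, d)),
    [/\ A = L *m R, row_full L & row_free R].
  by exists (col_base A), (row_base A); rewrite mulmx_base col_base_full row_base_free.
pose i0 := Ordinal r_gt0; pose i1 := Ordinal r_gt1.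
have nzu : col i0 L != 0.
  apply/eqP=> u0; have: L *m delta_mx i0 0 = L *m (0 : 'cV_(\rank A)) by rewrite -colE u0 mulmx0.
  move/(row_full_inj fL) => /matrixP/(_ i0 0)/eqP.
  by rewrite !mxE !eqxx oner_eq0.
have [B BX Bu] := X_trans (pinvmx R *m delta_mx i1 0) nzu.
pose M := R *m B *m L.
have Mi a : M != a%:M.
  have Mcol : col i0 M = delta_mx i1 0.
    by rewrite colE /M -!mulmxA -colE Bu mulmxA mulmxVp // mul1mx.
  apply/eqP => Ma; move: Mcol; rewrite Ma => /matrixP/(_ i1 0)/eqP.
  by rewrite !mxE /= eq_sym oner_eq0.
have [a rMa] := closed_eigenvalue M r_gt0.
have E : A *m B *m A - a *: A = L *m (M - a%:M) *m R.
  rewrite mulmxBr mulmxBl mul_mx_scalar -scalemxAl -A_LR /M !mulmxA -A_LR.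
  by rewrite -[X in X - _ = _]mulmxA [in LHS]A_LR !mulmxA -A_LR.
apply: (IHn (A *m B *m A - a *: A)).
- rewrite E -ltnS (leq_trans _ rA) //; apply: leq_ltn_trans rMa.
  by apply: leq_trans (mxrankM_maxl _ _) _; apply: mxrankM_maxr.
- by rewrite rpredB ?rpredZ // !XM.
rewrite E; apply: contra (Mi a) => /eqP.
rewrite -[X in _ = X](mul0mx _ R) => /(row_free_inj fR).
by rewrite -[X in _ = X](mulmx0 _ L) => /(row_full_inj fL)/eqP; rewrite subr_eq0.
Qed.

(** A rank one matrix c r yields every matrix unit once c and r can be moved to
    arbitrary vectors.  Transitivity on columns is assumed; on rows it follows,
    since a functional that kills r X is given by a column w with X w killed
    by r, which forces w = 0. *)
Theorem burnside A : A \in X.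
Proof.
have [c [r [crX nzc nzr]]] : exists (c : 'cV[k]_d) (r : 'rV[k]_d),
    [/\ c *m r \in X, c != 0 & r != 0].
  have [B BX rB] := burnside_rank1.
  have nzB : B != 0 by rewrite -mxrank_eq0 rB.
  move: BX nzB; rewrite -{1 2}(mulmx_base B).
  move: (col_base B) (row_base B); rewrite rB => c r crX nzcr; exists c, r; split=> //.
    by apply: contraNneq nzcr => ->; rewrite mul0mx.
  by apply: contraNneq nzcr => ->; rewrite mulmx0.
have rX (y : 'rV[k]_d) : exists2 B, B \in X & r *m B = y.
  pose rmul : 'Hom('M[k]_d, 'rV[k]_d) := linfun (mulmx r).
  suff: y \in (rmul @: X)%VS by case/memv_imgP=> B BX ->; exists B => //; rewrite lfunE.
  apply: ann_sep => f fX; pose w : 'cV[k]_d := \col_j f (delta_mx 0 j).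
  have fE z : f z = (z *m w) 0 0.
    rewrite {1}(row_sum_delta z) linear_sum mxE; apply: eq_bigr => j _.
    by rewrite linearZ /= mxE.
  have [w0|nzw] := eqVneq w 0; first by rewrite fE w0 mulmx0 mxE.
  case/eqP: nzr; apply/rowP=> j; have [B BX Bw] := X_trans (delta_mx j 0) nzw.
  have: f (r *m B) = 0 by apply: fX; apply/memv_imgP; exists B; rewrite ?lfunE.
  by rewrite fE -mulmxA Bw -colE !mxE.
rewrite (matrix_sum_delta A); apply: memv_suml => i _; apply: memv_suml => j _; rewrite memvZ //.
have [B1 B1X B1c] := X_trans (delta_mx i 0) nzc.
have [B2 B2X rB2] := rX (delta_mx 0 j).
rewrite -(mul_delta_mx (0 : 'I_1)) -B1c -rB2 mulmxA; apply: XM => //.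
by rewrite -mulmxA; apply: XM.
Qed.

End Burnside.

(** * Comatrix coalgebras *)

Section Comatrix.
Variables (k : fieldType) (C : vectType k) (cC : coalgebra C).
Implicit Types (f g : 'Hom(C, k^o)) (x y : C) (D E V X : {vspace C}).
Local Infix "**" := (conv cC) (at level 40, left associativity).
Local Notation eps := (counit cC).
Local Notation lh := (lh cC).
Local Notation rh := (rh cC).

Definition cspan d (c : 'I_d -> 'I_d -> C) : {vspace C} :=
  <<[seq c p.1 p.2 | p : 'I_d * 'I_d]>>%VS.

(** The c i j comultiply like the coordinate functions on matrices; phi is the
    dual family, whose existence says that the c i j are linearly independent. *)
Definition comatrix_basis d (c : 'I_d -> 'I_d -> C)
    (phi : 'I_d -> 'I_d -> 'Hom(C, k^o)) : Prop :=
  [/\ forall f g i j, (f ** g) (c i j) = \sum_l f (c i l) * g (c l j),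
      forall i j, eps (c i j) = (i == j)%:R
    & forall i j a b, phi i j (c a b) = ((i == a) && (j == b))%:R].

Section Basis.
Variables (d : nat) (c : 'I_d -> 'I_d -> C) (phi : 'I_d -> 'I_d -> 'Hom(C, k^o)).
Hypothesis cb : comatrix_basis c phi.

Lemma mem_cspan i j : c i j \in cspan c.
Proof. by apply: memv_span; apply/mapP; exists (i, j); rewrite ?mem_enum. Qed.

Lemma cspan_sub X : (forall i j, c i j \in X) -> (cspan c <= X)%VS.
Proof. by move=> cX; apply/span_subvP => _ /mapP[p _ ->]; apply: cX. Qed.

Lemma cspan_ext f g x :
  (forall i j, f (c i j) = g (c i j)) -> x \in cspan c -> f x = g x.
Proof.
move=> fg; suff /subvP H : (cspan c <= lker (f - g))%VS.
  by move/H; rewrite memv_ker add_lfunE opp_lfunE subr_eq0 => /eqP.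
by apply: cspan_sub => i j; rewrite memv_ker add_lfunE opp_lfunE fg subrr.
Qed.

Lemma ann_cspan f : ann (cspan c) f <-> (forall i j, f (c i j) = 0).
Proof.
split=> [fc i j|fc x xc]; first by rewrite fc ?mem_cspan.
by rewrite (@cspan_ext f 0 x) ?lfunE // => i j; rewrite fc lfunE.
Qed.

Lemma lh_comatrix f i j : lh f (c i j) = \sum_l f (c i l) *: c l j.
Proof.
have [cM _ _] := cb; apply: functional_sep => g; rewrite lhE cM linear_sum.
by apply: eq_bigr => l _; rewrite linearZ.
Qed.

Lemma rh_comatrix f i j : rh f (c i j) = \sum_l f (c l j) *: c i l.
Proof.
have [cM _ _] := cb; apply: functional_sep => g; rewrite rhE cM linear_sum.
by apply: eq_bigr => l _; rewrite linearZ /= mulrC.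
Qed.

Lemma lh_phi i l a b : lh (phi i l) (c a b) = (i == a)%:R *: c l b.
Proof.
have [_ _ dualP] := cb.
rewrite lh_comatrix (bigD1 l) //= dualP eqxx andbT big1 ?addr0 // => m ml.
by rewrite dualP [l == m]eq_sym (negPf ml) andbF scale0r.
Qed.

Lemma rh_phi l j a b : rh (phi l j) (c a b) = (j == b)%:R *: c a l.
Proof.
have [_ _ dualP] := cb.
rewrite rh_comatrix (bigD1 l) //= dualP eqxx big1 ?addr0 // => m ml.
by rewrite dualP [l == m]eq_sym (negPf ml) scale0r.
Qed.

Lemma cspan_coord x : x \in cspan c -> x = \sum_i \sum_j phi i j x *: c i j.
Proof.
move=> xc; apply: functional_sep => f.
pose g := \sum_i \sum_j f (c i j) *: phi i j.
have gE y : g y = \sum_i \sum_j f (c i j) * phi i j y.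
  rewrite sum_lfunE; apply: eq_bigr => i _; rewrite sum_lfunE.
  by apply: eq_bigr => j _; rewrite scale_lfunE.
rewrite (@cspan_ext f g x) // => [|a b].
  rewrite gE linear_sum; apply: eq_bigr => i _; rewrite linear_sum.
  by apply: eq_bigr => j _; rewrite linearZ /= mulrC.
have [_ _ dualP] := cb.
rewrite gE (bigD1 a) //= (bigD1 b) //= dualP !eqxx mulr1 !big1 ?addr0 //.
  move=> i ia; apply: big1 => j _; by rewrite dualP (negPf ia) mulr0.
by move=> j jb; rewrite dualP (negPf jb) andbF mulr0.
Qed.

Lemma dim_cspan : \dim (cspan c) = (d ^ 2)%N.
Proof.
have [_ _ dualP] := cb.
set s := [seq c p.1 p.2 | p : 'I_d * 'I_d].
have ss : size s = (d ^ 2)%N by rewrite size_map -cardE card_prod card_ord mulnn.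
suff fs : free s by rewrite /cspan (eqP fs).
pose p (i : 'I_#|{: 'I_d * 'I_d}|) := enum_val i.
have sE i : s`_(nat_of_ord i) = c (p i).1 (p i).2.
  by rewrite -(nth_image 0 (fun q => c q.1 q.2)).
apply/freeP => a; rewrite [tval _]/= => a0 i; have := congr1 (phi (p i).1 (p i).2) a0.
rewrite linear0 linear_sum (bigD1 i) //= linearZ /= sE dualP !eqxx /=.
rewrite [_ *: 1]mulr1 big1 ?addr0 // => j ji; rewrite linearZ /= sE.
rewrite dualP -xpair_eqE -!surjective_pairing; case: eqP => [pij|_]; last by rewrite scaler0.
by case/eqP: ji; apply: enum_val_inj.
Qed.

Lemma subcoalg_cspan : subcoalg cC (cspan c).
Proof.
have [cM _ _] := cb; apply: subcoalg_ann => f g fc; apply/ann_cspan => i j.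
  by rewrite cM big1 // => l _; rewrite fc ?mul0r // mem_cspan.
by rewrite cM big1 // => l _; rewrite fc ?mulr0 // mem_cspan.
Qed.

(** Cutting with matrix units on both sides isolates one coordinate; this is why
    a matrix algebra has no proper ideal. *)
Lemma cspan_corner i j a b x : x \in cspan c ->
  lh (phi i a) (rh (phi b j) x) = phi i j x *: c a b.
Proof.
move=> xc; rewrite {1}(cspan_coord xc) linear_sum /= linear_sum (bigD1 i) //=.
rewrite linear_sum linear_sum (bigD1 j) //= !linearZ /= rh_phi eqxx scale1r lh_phi eqxx scale1r.
rewrite !big1 ?addr0 //.
  move=> l li; rewrite linear_sum linear_sum big1 // => m _.
  by rewrite !linearZ /= rh_phi linearZ /= lh_phi [i == l]eq_sym (negPf li) scale0r !scaler0.
by move=> m mj; rewrite !linearZ /= rh_phi [j == m]eq_sym (negPf mj) scale0r !linear0.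
Qed.

Lemma simple_cspan : (0 < d)%N -> simple_subcoalg cC (cspan c).
Proof.
move=> d_gt0; split; first exact: subcoalg_cspan.
  by rewrite -dimv_eq0 dim_cspan -lt0n expn_gt0 d_gt0.
move=> D /subcoalgP[Dl Dr] Dc; have [->|nzD] := eqVneq D 0%VS; [by left | right].
apply/eqP; rewrite eqEsubv Dc; apply: cspan_sub => a b.
have xc : vpick D \in cspan c := subvP Dc _ (memv_pick D).
have [i [j nz]] : exists i j, phi i j (vpick D) != 0.
  apply: contrapT => no; move: nzD; rewrite -vpick0 (cspan_coord xc) big1 ?eqxx // => i _.
  apply: big1 => j _; have [->|nz] := eqVneq (phi i j (vpick D)) 0; first by rewrite scale0r.
  by case: no; exists i, j.
rewrite -[c a b]scale1r -(mulVf nz) -scalerA memvZ // -cspan_corner //.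
by apply/Dl/Dr/memv_pick.
Qed.

End Basis.
End Comatrix.

Section SimpleSubquotient.
Variables (k : closedFieldType) (C : vectType k) (cC : coalgebra C).
Implicit Types (f g : 'Hom(C, k^o)) (x y : C) (D E V X : {vspace C}).
Local Infix "**" := (conv cC) (at level 40, left associativity).
Local Notation eps := (counit cC).
Local Notation lh := (lh cC).
Local Notation rh := (rh cC).

(** Right coideals, as submodules for the left action of the dual algebra. *)
Definition rcoideal V : Prop := forall f x, x \in V -> rh f x \in V.

(** The coefficients of a simple subquotient V/X of the right regular comodule
    form a comatrix basis.  The matrices (f (c i j)), for f in the dual algebra,
    are an algebra which is transitive by minimality of V, so it is everything by
    Burnside's theorem; preimages of the matrix units are the dual family. *)
Lemma simple_subquotient V X :
    rcoideal X -> rcoideal V -> ~ (V <= X)%VS ->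
    (forall V', rcoideal V' -> (V' <= V)%VS -> ~ (V' <= X)%VS -> V' = V) ->
  exists d (c : 'I_d -> 'I_d -> C) phi,
    [/\ (0 < d)%N, comatrix_basis cC c phi,
        forall f x, ann (cspan c) f -> x \in V -> rh f x \in X
      & forall D, subcoalg cC D -> (V <= D)%VS -> (cspan c <= D)%VS].
Proof.
move=> Xr Vr nVX minV.
pose U := (V :\: X)%VS; have UV : (U <= V)%VS := diffvSl V X.
have UX0 : (U :&: X)%VS = 0%VS by rewrite /U capv_diff.
pose d := \dim U; pose v (i : 'I_d) := (vbasis U)`_i.
have vU i : v i \in U by apply: vbasis_mem; rewrite mem_nth ?size_tuple.
have vV i : v i \in V := subvP UV _ (vU i).
pose p := daddv_pi U X.
have pU x : x \in U -> p x = x by apply: daddv_pi_id.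
have pX x : x \in X -> p x = 0.
  move=> xX; have := daddv_pi_add UX0 (subvP (addvSr U X) _ xX).
  rewrite [in X in _ + X](daddv_pi_id _ xX) 1?capvC // => /eqP.
  by rewrite -subr_eq0 addrK => /eqP.
pose g i : 'Hom(C, k^o) := (linfun (coord (vbasis U) i : C -> k^o) \o p)%VF.
have gE i x : g i x = coord (vbasis U) i (p x) by rewrite comp_lfunE lfunE.
have gv i j : g i (v j) = (i == j)%:R.
  by rewrite gE pU // coord_free ?(basis_free (vbasisP U)) // eq_sym.
have gX i x : x \in X -> g i x = 0 by move=> xX; rewrite gE pX // linear0.
have Vdec x : x \in V -> x - \sum_i g i x *: v i \in X.
  rewrite -{1}(addv_diff_cap V X) => /memv_addP[u uU [w]].
  rewrite memv_cap => /andP[_ wX] ->.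
  suff ->: \sum_i g i (u + w) *: v i = u by rewrite addrC addKr.
  rewrite [RHS](coord_vbasis uU); apply: eq_bigr => i _.
  by rewrite linearD /= [g i w]gX // addr0 gE pU.
pose c i j := lh (g i) (v j).
have cE f i j : f (c i j) = g i (rh f (v j)) by rewrite lhE rhE.
have cM f h i j : (f ** h) (c i j) = \sum_l f (c i l) * h (c l j).
  rewrite cE -rh_rh; have /Vdec := Vr h _ (vV j).
  move/(Xr f)/(gX i); rewrite linearB linearB /= => /eqP; rewrite subr_eq0 => /eqP->.
  rewrite linear_sum linear_sum; apply: eq_bigr => l _.
  by rewrite !linearZ /= !cE mulrC.
have ceps i j : eps (c i j) = (i == j)%:R by rewrite cE rh1 gv.
have d_gt0 : (0 < d)%N.
  rewrite lt0n; apply/negP; rewrite dimv_eq0 => /eqP U0; apply: nVX.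
  by rewrite -(addv_diff_cap V X) -/U U0 add0v capvSr.
pose M (f : dual C) : 'M[k]_d := \matrix_(i, j) (f : 'Hom(C, k^o)) (c i j).
have M_lin : linear M.
  by move=> a f h; apply/matrixP=> i j; rewrite !mxE add_lfunE scale_lfunE.
have [R Rdef] := linear_image M_lin.
have memR A : A \in R -> exists f, A = M f by move/Rdef.
have Rmem f : M f \in R by apply/Rdef; exists f.
have RM A B : A \in R -> B \in R -> A *m B \in R.
  move=> /memR[f ->] /memR[h ->]; suff ->: M f *m M h = M (f ** h) by apply: Rmem.
  by apply/matrixP=> i j; rewrite !mxE cM; apply: eq_bigr => l _; rewrite !mxE.
have R_trans (u w : 'cV[k]_d) : u != 0 -> exists2 A, A \in R & A *m u = w.
  move=> nzu; pose y := \sum_j u j 0 *: v j; pose z := \sum_j w j 0 *: v j.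
  have yU : y \in U by apply: memv_suml => j _; rewrite memvZ.
  have gy i : g i y = u i 0.
    rewrite linear_sum (bigD1 i) //= linearZ /= gv eqxx [_ *: _]mulr1 big1 ?addr0 // => j ji.
    by rewrite linearZ /= gv eq_sym (negPf ji) scaler0.
  pose O f := rh f y.
  have O_lin : linear (O : dual C -> C).
    move=> a f h; apply: functional_sep => l; rewrite linearP /= !rhE.
    by rewrite -!lhE add_lfunE scale_lfunE.
  have [V' V'def] := linear_image O_lin.
  have memV' x : x \in V' -> exists f, x = rh f y by move/V'def.
  have V'mem f : rh f y \in V' by apply/V'def; exists f.
  have V'V : V' = V.
    apply: minV => [f x /memV'[h ->]||V'X]; first by rewrite rh_rh.
      by apply/subvP => x /memV'[h ->]; apply: Vr; apply: (subvP UV).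
    case/eqP: nzu; apply/colP => i; rewrite mxE -gy gX //.
    by apply: (subvP V'X); rewrite -[y](rh1 cC).
  have: z \in V by apply: memv_suml => j _; rewrite memvZ.
  rewrite -V'V => /memV'[f zE]; exists (M f) => //.
  apply/colP => i; rewrite !mxE.
  have <-: g i z = w i 0.
    rewrite linear_sum (bigD1 i) //= linearZ /= gv eqxx [_ *: _]mulr1 big1 ?addr0 // => j ji.
    by rewrite linearZ /= gv eq_sym (negPf ji) scaler0.
  rewrite zE linear_sum linear_sum; apply: eq_bigr => j _.
  by rewrite !linearZ /= mxE cE mulrC.
have allR : forall A, A \in R by apply: burnside.
pose phi i j := sval (cid (memR _ (allR (delta_mx i j)))).
have phiE i j a b : phi i j (c a b) = ((i == a) && (j == b))%:R.
  have /matrixP/(_ a b) := svalP (cid (memR _ (allR (delta_mx i j)))).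
  by rewrite !mxE => <-; rewrite [i == a]eq_sym [j == b]eq_sym.
exists d, c, phi; split=> // [f x fc xV|D /subcoalgP[Dl _] VD].
  have fx0 i j : g i (rh f (v j)) = 0 by rewrite -cE fc // mem_cspan.
  have fvX j : rh f (v j) \in X.
    by have := Vdec _ (Vr f _ (vV j)); rewrite big1 ?subr0 // => i _; rewrite fx0 scale0r.
  have /(Xr f) := Vdec _ xV; rewrite linearB /= => fX.
  rewrite -[rh f x](subrK (rh f (\sum_i g i x *: v i))) memvD //.
  by rewrite linear_sum; apply: memv_suml => i _; rewrite linearZ /= memvZ // fvX.
by apply: cspan_sub => i j; apply: Dl; apply: (subvP VD).
Qed.

End SimpleSubquotient.

(** * Simple subcoalgebras and links between them *)

Section Links.
Variables (k : closedFieldType) (C : vectType k) (cC : coalgebra C).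
Implicit Types (f g e : 'Hom(C, k^o)) (x y : C) (D E V X : {vspace C}).
Local Infix "**" := (conv cC) (at level 40, left associativity).
Local Notation eps := (counit cC).
Local Notation lh := (lh cC).
Local Notation rh := (rh cC).
Local Notation C0 := (coradical cC).
Local Notation CF := (corad_filt cC).
Local Notation simple := (simple_subcoalg cC).

(** A minimal right coideal of D has its coefficients in D, and they span a
    nonzero subcoalgebra. *)
Lemma simple_comatrix D : simple D ->
  exists d (c : 'I_d -> 'I_d -> C) phi,
    [/\ (0 < d)%N, comatrix_basis cC c phi & D = cspan c].
Proof.
move=> [cD nzD minD]; have /subcoalgP[_ Dr] := cD.
have [|V [[Vr nzV] VD] minV] :=
  @min_vspace _ _ (fun V => rcoideal cC V /\ ~ (V <= 0)%VS) D.
  by split=> [//|]; rewrite subv0; apply/negP.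
have [|V' V'r V'V nzV'|d [c [phi [d_gt0 cb cX csub]]]] := simple_subquotient _ Vr nzV.
- by move=> f x; rewrite !memv0 => /eqP->; rewrite linear0.
- by apply: minV.
exists d, c, phi; split=> //.
have [Z|//] := minD _ (subcoalg_cspan cb) (csub _ cD VD).
by have [_ /eqP] := simple_cspan cb d_gt0.
Qed.

Lemma simple_dim D : simple D -> exists2 d, (0 < d)%N & \dim D = (d ^ 2)%N.
Proof.
by move=> /simple_comatrix[d [c [phi [d_gt0 cb ->]]]]; exists d; rewrite ?(dim_cspan cb).
Qed.

(** The ideal J is nilpotent.  Otherwise the filtration stops at a proper C_n;
    a minimal right coideal V that is not in C_n has V/(V :&: C_n) simple, with
    coefficients in the coradical, so J V is in C_n and V is in C_(n+1) = C_n,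
    a contradiction. *)
Lemma corad_filt_full : exists n, CF n = fullv.
Proof.
have [n En] : exists n, CF n = CF n.+1.
  apply: contrapT => /forallNP nE.
  suff H n : (n <= \dim (CF n))%N.
    by have := H (\dim {:C}).+1; rewrite ltnNge dimvS ?subvf.
  elim: n => // n IHn; apply: leq_ltn_trans IHn _; rewrite ltnNge; apply/negP => d.
  by case: (nE n); apply/eqP; rewrite eqEdim corad_filt_incr.
exists n; apply: contrapT => nfull.
have [_ Xr] := (subcoalgP _ _).1 (subcoalg_corad_filt cC n).
have [|V [[Vr nVX] _] minV] :=
    @min_vspace _ _ (fun V => rcoideal cC V /\ ~ (V <= CF n)%VS) fullv.
  split=> [f x _|]; first exact: memvf.
  by move=> sub; apply/nfull/eqP; rewrite eqEsubv subvf.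
have [V' V'r V'V nzV'|d [c [phi [d_gt0 cb cX _]]]] := simple_subquotient Xr Vr nVX.
  by apply: minV.
apply: nVX; apply/subvP => x xV; rewrite En -(addn0 n); apply/corad_filtD => f g fA gB.
rewrite -rhE; apply: fA; apply: cX => // y yc; apply: gB.
exact: subvP (simple_sub_coradical (simple_cspan cb d_gt0)) _ yc.
Qed.

(** Modulo J, the annihilator of the coradical, such an e becomes the central
    idempotent of the dual algebra that belongs to D. *)
Definition indicator D e : Prop :=
  (forall x, x \in D -> e x = eps x) /\ (forall E, simple E -> E <> D -> ann E e).

Lemma simple_cap D E : simple D -> simple E -> E <> D -> (D :&: E)%VS = 0%VS.
Proof.
move=> [cD nzD minD] [cE nzE minE] ED.
have cDE : subcoalg cC (D :&: E)%VS.
  have [/subcoalgP[Dl Dr] /subcoalgP[El Er]] := (cD, cE).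
  by apply/subcoalgP; split=> f x; rewrite !memv_cap => /andP[xD xE]; apply/andP; auto.
have [//|eD] := minD _ cDE (capvSl _ _).
have [//|eE] := minE _ cDE (capvSr _ _).
by case: ED; rewrite -eE.
Qed.

Lemma counit_nz D : simple D -> ~ ann D eps.
Proof.
move=> [/subcoalgP[Dl _] /eqP nzD _] D0; apply: nzD; apply/eqP.
rewrite -subv0; apply/subvP => x xD; apply: ann_sep => f _.
by rewrite -(conv1r cC f) -lhE; apply/D0/Dl.
Qed.

(** Chinese remainders: the product of functionals that agree with the counit on D
    and vanish on one of the other components each. *)
Lemma indicator_seq D (s : seq {vspace C}) : simple D ->
  exists2 e : 'Hom(C, k^o), (forall x, x \in D -> e x = eps x)
    & forall E, E \in s -> simple E -> E <> D -> ann E e.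
Proof.
move=> sD; elim: s => [|E s [e eD es]]; first by exists eps.
have [noE|] := pselect (~ (simple E /\ E <> D)).
  exists e => // F; rewrite inE => /predU1P[-> sE ED|]; last exact: es.
  by case: noE.
move=> /contrapT[sE ED]; have cap0 := simple_cap sD sE ED.
pose a : 'Hom(C, k^o) := (eps \o daddv_pi D E)%VF.
have aD x : x \in D -> a x = eps x by move=> xD; rewrite comp_lfunE daddv_pi_id.
have aE : ann E a.
  move=> x xE; rewrite comp_lfunE.
  have := daddv_pi_add cap0 (subvP (addvSr D E) _ xE).
  rewrite [in X in _ + X](daddv_pi_id _ xE) 1?capvC // => /eqP.
  by rewrite -subr_eq0 addrK => /eqP->; rewrite linear0.
exists (e ** a) => [x xD|F]; last first.
  rewrite inE => /predU1P[-> _ _|Fs sF FD]; first by apply: ann_convr => //; case: sE.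
  by apply: ann_convl (es _ Fs sF FD); case: sF.
have [/subcoalgP[Dl _] _ _] := sD.
by rewrite -lhE aD ?Dl // -[in RHS](lh1 cC x) !lhE conv1l conv1r eD.
Qed.

(** The coradical is a finite sum of simple subcoalgebras, and a simple
    subcoalgebra outside of that finite list would have an indicator that
    vanishes on the whole coradical. *)
Lemma simples : exists s : seq {vspace C},
  [/\ uniq s, forall D, D \in s <-> simple D
    & forall f, (forall D, simple D -> ann D f) -> ann C0 f].
Proof.
have [_ [s sP C0s]] := vsumP (simple_subcoalg cC); rewrite -/C0 in C0s.
have C0P f : (forall D, D \in s -> ann D f) -> ann C0 f.
  rewrite C0s; elim: (s) => [_ x|D r IHr Df].
    by rewrite big_nil memv0 => /eqP->; rewrite linear0.
  move=> x; rewrite big_cons => /memv_addP[u uD [v vr ->]]; rewrite linearD /=.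
  rewrite (Df D) ?mem_head // add0r; apply: IHr vr => E Er.
  by apply: Df; rewrite inE Er orbT.
exists (undup s); split=> [|D|f fs]; first exact: undup_uniq.
  rewrite mem_undup; split=> [/sP //|sD]; apply: contrapT => nDs.
  have [e eD es] := indicator_seq s sD.
  apply: (counit_nz sD) => x xD; rewrite -eD //.
  apply: C0P (subvP (simple_sub_coradical sD) _ xD) => E Es.
  by apply: es => //; [apply: sP | move=> ED; apply: nDs; rewrite -ED].
by apply: C0P => D Ds; apply: fs; apply: sP.
Qed.

Lemma ann_coradical f : (forall D, simple D -> ann D f) -> ann C0 f.
Proof. by have [s [_ _ H]] := simples; apply: H. Qed.

Lemma indicator_ex D : simple D -> exists e, indicator D e.
Proof.
move=> sD; have [s [_ sP _]] := simples; have [e eD es] := indicator_seq s sD.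
by exists e; split=> // E sE; apply: es => //; apply/sP.
Qed.

Lemma indicator_eq D e e' : simple D -> indicator D e -> indicator D e' -> ann C0 (e - e').
Proof.
move=> sD [eD eE] [eD' eE']; apply: ann_coradical => F sF x xF.
rewrite add_lfunE opp_lfunE; have [FD|FD] := pselect (F = D).
  by rewrite eD ?eD' ?subrr // -FD.
by rewrite (eE _ sF FD) // (eE' _ sF FD) // subrr.
Qed.

Lemma indicator_id D e : simple D -> indicator D e -> ann C0 (e ** e - e).
Proof.
move=> sD [eD eE]; apply: ann_coradical => F sF x xF.
have [cF _ _] := sF; have /subcoalgP[Fl _] := cF.
rewrite add_lfunE opp_lfunE; have [FD|FD] := pselect (F = D).
  rewrite -lhE eD -?FD ?Fl // -[e in X in _ - X](conv1r cC) -lhE subrr //.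
by rewrite (eE _ sF FD) // (ann_convl _ cF (eE _ sF FD)) // subrr.
Qed.

Lemma indicator_partition : exists (s : seq {vspace C}) (e : {vspace C} -> 'Hom(C, k^o)),
  [/\ forall D, D \in s -> simple D, forall D, D \in s -> indicator D (e D)
    & ann C0 (eps - \sum_(D <- s) e D)].
Proof.
have [s [us sP C0P]] := simples.
have /choice[e eP] : forall D, exists e, simple D -> indicator D e.
  move=> D; have [/indicator_ex[e]|nsD] := pselect (simple D); first by exists e.
  by exists 0.
exists s, e; split=> [D /sP //|D /sP/eP //|].
apply: C0P => E sE x xE; rewrite add_lfunE opp_lfunE sum_lfunE.
have Es : E \in s by apply/sP.
rewrite (bigD1_seq E) //= (eP E sE).1 // big_seq_cond big1 ?addr0 ?subrr // => D.
by case/andP=> /sP sD /eqP DE; apply: (eP D sD).2 xE => // ED; apply: DE.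
Qed.

Lemma ann_corad_filtD a b f g :
  ann (CF a) f -> ann (CF b) g -> ann (CF (a + b).+1) (f ** g).
Proof. by move=> fA gB x /corad_filtD; apply. Qed.

Lemma ann_corad_filt_mull n f g : ann (CF n) f -> ann (CF n) (g ** f).
Proof. exact: ann_convr (subcoalg_corad_filt cC n). Qed.

Lemma ann_corad_filt_mulr n f g : ann (CF n) f -> ann (CF n) (f ** g).
Proof. exact: ann_convl (subcoalg_corad_filt cC n). Qed.

(** With J the annihilator of the coradical, this says that e J^(n+1) e' is not
    contained in J^(n+2); the index n stands for the layer n + 1 of the coradical
    filtration. *)
Definition link_via n e e' : Prop :=
  exists a x, [/\ ann (CF n) a, x \in CF n.+1 & (e ** a ** e') x != 0].

Definition link n D E : Prop :=
  forall e e', indicator D e -> indicator E e' -> link_via n e e'.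

Lemma link_viaE n e e' a : ann (CF n) a -> ~ ann (CF n.+1) (e ** a ** e') ->
  link_via n e e'.
Proof.
move=> aA /existsNP[x /not_implyP[xC /eqP nz]]; by exists a, x.
Qed.

(** Two indicators of D differ by an element of J, and J J^(n+1) = J^(n+2). *)
Lemma link_indep n D E e e' : simple D -> simple E ->
  indicator D e -> indicator E e' -> link_via n e e' -> link n D E.
Proof.
move=> sD sE De Ee' [a [x [aA xC nz]]] f f' Df Ef'; exists a, x; split=> //.
suff <- : (e ** a ** e') x = (f ** a ** f') x by [].
transitivity ((f ** a ** e') x).
  apply/eqP; rewrite -subr_eq0 -!convA -opp_lfunE -add_lfunE -convBl; apply/eqP.
  apply: (@ann_corad_filtD 0 n _ _ _ _ x xC); first exact: indicator_eq De Df.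
  exact: ann_corad_filt_mulr.
apply/eqP; rewrite -subr_eq0 -!convA -opp_lfunE -add_lfunE -!convBr; apply/eqP.
apply: ann_corad_filt_mull xC; rewrite -(addn0 n).
by apply: ann_corad_filtD => //; apply: indicator_eq Ee' Ef'.
Qed.

(** The functional a in J^(i+j+2) can be traded for a product b ** c with b in
    J^(i+1) and c in J^(j+1), because the latter products span.  Between b and c
    the counit is the sum of the indicators up to J, so one of the e_F survives. *)
Lemma link_split i j D E : simple D -> simple E -> link (i + j).+1 D E ->
  exists F, [/\ simple F, link i D F & link j F E].
Proof.
move=> sD sE; have [e De] := indicator_ex sD; have [e' Ee'] := indicator_ex sE.
move=> /(_ e e' De Ee')[a [x [aA xC nz]]].
pose y := lh e (rh e' x).
have [b [c [bA cA nzbc]]] : exists b c, [/\ ann (CF i) b, ann (CF j) c & (b ** c) y != 0].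
  apply: contrapT => no; case/eqP: nz; rewrite -rhE -lhE -/y; apply: aA.
  apply/corad_filtD => b c bA cA; apply: contrapT => /eqP nz; apply: no.
  by exists b, c.
have [s [ind [sS sI part]]] := indicator_partition.
have [F Fs nzF] : exists2 F, F \in s & (e ** b ** ind F ** c ** e') x != 0.
  apply: contrapT => no; case/eqP: nzbc; rewrite lhE rhE.
  have : (e ** b ** (eps - \sum_(F <- s) ind F) ** c ** e') x = 0.
    apply: ann_corad_filt_mulr xC; rewrite -!convA; apply: ann_corad_filt_mull.
    rewrite convA -(addn0 i) -addSn; apply: ann_corad_filtD => //.
    exact: ann_corad_filtD.
  rewrite convBr conv1r !convBl add_lfunE opp_lfunE convA => /eqP; rewrite subr_eq0 => /eqP->.
  rewrite conv_sumr !conv_suml sum_lfunE big_seq big1 // => F Fs.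
  by apply/eqP; apply: contrapT => /negP nzF; apply: no; exists F.
exists F; split; first exact: sS.
  apply: (link_indep sD (sS _ Fs) De (sI _ Fs)); apply: (link_viaE bA) => zero.
  case/eqP: nzF; rewrite -convA; rewrite -addSn in xC.
  exact: (ann_corad_filtD zero (ann_corad_filt_mulr e' cA) xC).
apply: (link_indep (sS _ Fs) sE (sI _ Fs) Ee'); apply: (link_viaE cA) => zero.
case/eqP: nzF; rewrite -!convA [_ ** (b ** _)]convA [ind F ** _]convA; rewrite -addnS in xC.
exact: (ann_corad_filtD (ann_corad_filt_mull e bA) zero xC).
Qed.

(** If nothing is linked to D further out, e J^(m+1) is in J^(m+2) for every
    m >= n, and e J^(n+1) = 0 by nilpotency. *)
Lemma link_vanish n D e : simple D -> indicator D e -> e ** e = e ->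
    (forall m E, (n <= m)%N -> simple E -> ~ link m D E) ->
  forall a, ann (CF n) a -> e ** a = 0.
Proof.
move=> sD De ee noL.
have step m a : (n <= m)%N -> ann (CF m) a -> ann (CF m.+1) (e ** a).
  move=> nm aA x xC; have [s [ind [sS sI part]]] := indicator_partition.
  have : (e ** a ** (eps - \sum_(F <- s) ind F)) x = 0.
    rewrite -convA; apply: ann_corad_filt_mull xC.
    by rewrite -(addn0 m); apply: ann_corad_filtD.
  rewrite convBr conv1r add_lfunE opp_lfunE => /eqP; rewrite subr_eq0 => /eqP->.
  rewrite conv_sumr sum_lfunE big_seq big1 // => F Fs; apply: contrapT => /eqP nz.
  apply: (noL m F nm (sS _ Fs)); apply: (link_indep sD (sS _ Fs) De (sI _ Fs)).
  by exists a, x.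
have all a r : ann (CF n) a -> ann (CF (n + r)) (e ** a).
  move=> aA; elim: r => [|r IHr]; first by rewrite addn0; apply: ann_corad_filt_mull.
  by rewrite addnS -ee -convA; apply: step => //; apply: leq_addr.
move=> a aA; have [N CN] := corad_filt_full; apply/lfunP => x; rewrite [RHS]lfunE.
apply: (all a N aA x); apply: (subvP (corad_filt_mono cC (leq_addl n N))).
by rewrite CN memvf.
Qed.

End Links.

(** * Coalgebra similitudes and Frobenius forms *)

Section Similitude.
Variables (k : closedFieldType) (C : vectType k) (cC : coalgebra C).
Implicit Types (f g e : 'Hom(C, k^o)) (x y : C) (D E V X : {vspace C}).
Local Infix "**" := (conv cC) (at level 40, left associativity).
Local Notation eps := (counit cC).
Local Notation lh := (lh cC).
Local Notation rh := (rh cC).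
Local Notation C0 := (coradical cC).
Local Notation CF := (corad_filt cC).
Local Notation simple := (simple_subcoalg cC).

(** Both the antipode and the transpose of the Nakayama automorphism are of this
    kind; such maps preserve the subcoalgebras whichever order they induce on
    convolution products. *)
Definition similitude (th : 'End(C)) : Prop :=
  [/\ lker th == 0%VS, (eps \o th)%VF = eps & coalg_hom cC th \/ coalg_antihom cC th].

Section Fix.
Variable th : 'End(C).
Hypothesis thS : similitude th.

Let th0 : lker th == 0%VS. Proof. by case: thS. Qed.

Lemma ann_img X f : ann (th @: X)%VS f <-> ann X (f \o th)%VF.
Proof.
split=> [Xf x xX|Xf _ /memv_imgP[x xX ->]]; last by rewrite -comp_lfunE Xf.
by rewrite comp_lfunE Xf ?memv_img.
Qed.

Lemma subcoalg_img X : subcoalg cC (th @: X)%VS <-> subcoalg cC X.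
Proof.
have [_ _ thM] := thS; split=> cX.
  apply: subcoalg_ann => f g Xf; rewrite -(lker0_compfVK th0 f) -(lker0_compfVK th0 g);
    set f' := (f \o _)%VF; set g' := (g \o _)%VF;
    have /ann_img Xf' : ann X (f' \o th)%VF by rewrite lker0_compfVK.
    by case: thM => <-; apply/ann_img; [apply: ann_convl|apply: ann_convr].
  by case: thM => <-; apply/ann_img; [apply: ann_convr|apply: ann_convl].
apply: subcoalg_ann => f g /ann_img Xf; apply/ann_img.
  by case: thM => ->; [apply: ann_convl|apply: ann_convr].
by case: thM => ->; [apply: ann_convr|apply: ann_convl].
Qed.

Lemma img_preimK X : (th @: (th @^-1: X))%VS = X.
Proof. by rewrite lpreimK // lker0_limgf // subvf. Qed.

Lemma dim_img X : \dim (th @: X) = \dim X.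
Proof. by rewrite limg_dim_eq // (eqP th0) capv0. Qed.

Lemma img_subv X Y : (th @: X <= th @: Y)%VS -> (X <= Y)%VS.
Proof.
move=> /subvP XY; apply/subvP => x xX.
by have /memv_imgP[y yY /(lker0P th0)->] := XY _ (memv_img th xX).
Qed.

Lemma img_inj X Y : (th @: X = th @: Y)%VS -> X = Y.
Proof. by move=> XY; apply/eqP; rewrite eqEsubv; apply/andP; split; apply: img_subv; rewrite XY. Qed.

Lemma simple_img D : simple (th @: D)%VS <-> simple D.
Proof.
split=> [] [cD nzD minD].
  split=> [||D' cD' D'D]; first exact/subcoalg_img.
    by apply: contraNneq nzD => ->; rewrite limg0.
  have [||E|E] := minD (th @: D')%VS; first exact/subcoalg_img.
  - exact: limgS.
  - by left; apply: img_inj; rewrite limg0.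
  by right; apply: img_inj.
split=> [||D' cD' D'D]; first exact/subcoalg_img.
  by apply: contraNneq nzD => D0; rewrite (@img_inj D 0%VS) // limg0.
rewrite -(img_preimK D') in cD' D'D *.
have [||->|->] := minD (th @^-1: D')%VS; first exact/subcoalg_img.
- exact: img_subv.
- by left; rewrite limg0.
by right.
Qed.

Lemma simple_preim D : simple D -> simple (th @^-1: D)%VS.
Proof. by move=> sD; apply/simple_img; rewrite img_preimK. Qed.

Lemma dim_preim D : \dim (th @^-1: D) = \dim D.
Proof. by rewrite -dim_img img_preimK. Qed.

Lemma ann_coradical_sim f : ann C0 f -> ann C0 (f \o th)%VF.
Proof.
move=> fC; apply: ann_coradical => D sD; apply/ann_img.
by apply: annS fC; apply/simple_sub_coradical/simple_img.
Qed.

Lemma ann_corad_filt_sim n f : ann (CF n) f -> ann (CF n) (f \o th)%VF.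
Proof.
elim: n f => [|n IHn] f fC; first exact: ann_coradical_sim.
apply/ann_img/(annS _ fC)/subvP => _ /memv_imgP[x xC ->].
apply/corad_filtS => g h gA hB; rewrite -comp_lfunE; have [_ _ [->|->]] := thS.
  by move/corad_filtS: xC; apply; [apply: ann_coradical_sim|apply: IHn].
move: xC; rewrite -(addn0 n) => /corad_filtD; apply; first exact: IHn.
exact: ann_coradical_sim.
Qed.

Lemma corad_filt_sim n x : (th x \in CF n) = (x \in CF n).
Proof.
have sub : (th @: CF n <= CF n)%VS.
  by apply/subvP => y yC; apply: ann_sep => f /ann_corad_filt_sim/ann_img; apply.
have E : (th @: CF n)%VS = CF n by apply/eqP; rewrite eqEdim sub dim_img leqnn.
rewrite -{1}E; apply/idP/idP => [/memv_imgP[y yC thxy]|]; last exact: memv_img.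
by rewrite (lker0P th0 _ _ thxy).
Qed.

Lemma indicator_sim D e : indicator cC D e -> indicator cC (th @^-1: D)%VS (e \o th)%VF.
Proof.
have [_ epsE _] := thS; move=> [eD eE]; split=> [x|E sE ED].
  by rewrite -memv_preim => xD; rewrite comp_lfunE eD // -comp_lfunE epsE.
apply/ann_img; apply: eE => [|ED']; first exact/simple_img.
by apply: ED; apply: img_inj; rewrite img_preimK.
Qed.

(** Composition with th reverses the products e ** a ** e'. *)
Lemma link_antihom n D E : simple D -> simple E -> coalg_antihom cC th ->
  link cC n D E -> link cC n (th @^-1: E)%VS (th @^-1: D)%VS.
Proof.
move=> sD sE thA L; have [e De] := indicator_ex sD; have [e' Ee'] := indicator_ex sE.
have [a [x [aA xC nz]]] := L e e' De Ee'.
apply: (link_indep (simple_preim sE) (simple_preim sD) (indicator_sim Ee') (indicator_sim De)).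
exists (a \o th)%VF, (th^-1%VF x); split; first exact: ann_corad_filt_sim.
  by rewrite -corad_filt_sim lker0_lfunVK.
by rewrite -convA -!thA comp_lfunE lker0_lfunVK.
Qed.

End Fix.

Section Frobenius.
Variable t : C.
Hypothesis t_nondeg : forall f, rh f t = 0 -> f = 0.

Lemma dim_functionals : \dim {: dual C} = \dim {: C}.
Proof. by rewrite !dimvf [LHS]muln1. Qed.

Lemma rh_lfun : exists G : 'Hom(dual C, C), forall f, G f = rh f t.
Proof.
apply: linear_lfun => a f g; apply: functional_sep => h.
by rewrite linearP /= !rhE -!lhE add_lfunE scale_lfunE.
Qed.

Lemma lh_lfun : exists G : 'Hom(dual C, C), forall f, G f = lh f t.
Proof.
apply: linear_lfun => a f g; apply: functional_sep => h.
by rewrite linearP /= !lhE -!rhE add_lfunE scale_lfunE.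
Qed.

Lemma functionals_onto (G : 'Hom(dual C, C)) : lker G == 0%VS -> limg G = fullv.
Proof.
move=> /eqP G0; apply/eqP.
by rewrite eqEdim subvf limg_dim_eq ?G0 ?capv0 // dim_functionals leqnn.
Qed.

Lemma frobenius_surj x : exists f, x = rh f t.
Proof.
have [G GE] := rh_lfun.
have G0 : lker G == 0%VS.
  rewrite -subv0; apply/subvP => f; rewrite memv_ker GE => /eqP/t_nondeg->.
  exact: mem0v.
have : x \in limg G by rewrite functionals_onto // memvf.
by case/memv_imgP => f _ ->; exists f; rewrite GE.
Qed.

Lemma frobenius_inj_l f : lh f t = 0 -> f = 0.
Proof.
move=> ft; apply/lfunP => x; have [g ->] := frobenius_surj x.
by rewrite rhE -lhE ft linear0 lfunE.
Qed.

(** The map lh b t |-> rh b t, which makes sense because b |-> lh b t is bijective.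
    Its transpose n satisfies b (n f) = f b under evaluation at t, so it is the
    Nakayama automorphism of the form, and it is multiplicative. *)
Lemma nakayama : exists th, [/\ similitude th, coalg_hom cC th
  & forall f b, (b ** (f \o th)%VF) t = (f ** b) t].
Proof.
have [Gr GrE] := rh_lfun; have [Gl GlE] := lh_lfun.
have Gr0 : lker Gr == 0%VS.
  by rewrite -subv0; apply/subvP => f; rewrite memv_ker GrE => /eqP/t_nondeg->; apply: mem0v.
have Gl0 : lker Gl == 0%VS.
  by rewrite -subv0; apply/subvP => f; rewrite memv_ker GlE => /eqP/frobenius_inj_l->; apply: mem0v.
pose th : 'End(C) := (Gr \o Gl^-1)%VF.
have thE b : th (lh b t) = rh b t.
  by rewrite comp_lfunE -GlE lker0_lfunK // GrE.
have onto x : exists b, x = lh b t.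
  have : x \in limg Gl by rewrite functionals_onto // memvf.
  by case/memv_imgP => b _ ->; exists b; rewrite GlE.
have nak f b : (b ** (f \o th)%VF) t = (f ** b) t.
  by rewrite -lhE comp_lfunE thE rhE.
have th_hom : coalg_hom cC th.
  move=> f g; apply/lfunP => x; have [b ->] := onto x.
  by rewrite comp_lfunE thE rhE lhE convA nak convA nak convA.
exists th; split=> //; split; last by left.
  rewrite -subv0; apply/subvP => x; rewrite memv_ker memv0.
  have [b ->] := onto x; rewrite thE => /eqP/t_nondeg->.
  by apply/eqP/functional_sep => f; rewrite lhE -rhE lfunE linear0.
apply/lfunP => x; have [b ->] := onto x.
by rewrite comp_lfunE thE rhE lhE conv1l conv1r.
Qed.

(** If e_D J^(n+2) = 0 then e_D a j = 0 for a in J^(n+1) and j in J.  Let E differ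
    from the component D' which carries the Nakayama image of e_D.  Under
    evaluation at t, the product e_D a e_E g equals e_D a (e_E g e_D'), where
    e_E g e_D' is in J; so e_D a e_E pairs to zero with every g, and vanishes. *)
Lemma frobenius_socle n D E e : simple D -> simple E -> indicator cC D e -> e ** e = e ->
    link cC n D E -> (forall a, ann (CF n.+1) a -> e ** a = 0) -> \dim D = \dim E.
Proof.
move=> sD sE De ee L top; have [th [thS _ nak]] := nakayama.
have [<-|ED] := pselect ((th @^-1: D)%VS = E); first by rewrite (dim_preim thS).
have [e' Ee'] := indicator_ex sE; have [a [x [aA xC /eqP[]]]] := L e e' De Ee'.
have [g ->] := frobenius_surj x; rewrite rhE -ee -!convA -nak -!convA.
rewrite top ?lfunE // -(addn0 n); apply: ann_corad_filtD => //.
apply: ann_coradical => F sF; have [cF _ _] := sF.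
have [FE|FE] := pselect (F = E); last exact: ann_convl (Ee'.2 F sF FE).
do 2!apply: ann_convr => //; apply: (indicator_sim thS De).2 => // FD.
by apply: ED; rewrite -FD.
Qed.

End Frobenius.
End Similitude.

(** * Sweedler sums *)

Section Sweedler.
Variables (k : fieldType) (C : vectType k) (cC : coalgebra C).
Implicit Types (W : vectType k) (x y : C).
Local Infix "**" := (conv cC) (at level 40, left associativity).
Local Notation eps := (counit cC).

(** Sweedler notation: [sw (fun u v => b u v) x] is the sum of the b(x_1, x_2).  The
    function b is evaluated on basis vectors only, which spares most of the
    multilinearity conditions below. *)
Definition sw W (b : C -> C -> W) x : W := tlift b (comul cC x).

Let e (i : 'I_(\dim {:C})) : C := (vbasis {:C})`_i.
Let c (i : 'I_(\dim {:C})) : 'Hom(C, k^o) := linfun (coord (vbasis {:C}) i : C -> k^o).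

Let cE i x : c i x = coord (vbasis {:C}) i x. Proof. by rewrite lfunE. Qed.
Let basisE x : x = \sum_i c i x *: e i.
Proof. by rewrite {1}(coord_vbasis (memvf x)); apply: eq_bigr => i _; rewrite cE. Qed.

Lemma swE W (b : C -> C -> W) x :
  sw b x = \sum_i \sum_j (c i ** c j) x *: b (e i) (e j).
Proof.
rewrite [sw b x]tlift_def; apply: eq_bigr => i _; apply: eq_bigr => j _.
by rewrite convE -tens_coord.
Qed.

Lemma sw_linear W (b : C -> C -> W) : linear (sw b).
Proof. by move=> a x y; rewrite /sw !linearP. Qed.

Lemma swZr W (b : C -> C -> W) a x : sw b (a *: x) = a *: sw b x.
Proof. by rewrite /sw !linearZ. Qed.

Lemma sw_linear_arg (V W : vectType k) (b : V -> C -> C -> W) x :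
  (forall u v, linear (fun w => b w u v)) -> linear (fun w => sw (b w) x).
Proof.
move=> bl a u v; rewrite !swE scaler_sumr -big_split; apply: eq_bigr => i _ /=.
rewrite scaler_sumr -big_split; apply: eq_bigr => j _ /=.
by rewrite bl scalerDr !scalerA mulrC.
Qed.

Lemma sw_ext W (b b' : C -> C -> W) x : (forall u v, b u v = b' u v) -> sw b x = sw b' x.
Proof.
by move=> bb; rewrite !swE; apply: eq_bigr => i _; apply: eq_bigr => j _; rewrite bb.
Qed.

Lemma sw_morph W W' (h : W -> W') (b : C -> C -> W) x : linear h ->
  h (sw b x) = sw (fun u v => h (b u v)) x.
Proof.
move=> /linear_lfun[G GE]; rewrite -GE !swE linear_sum; apply: eq_bigr => i _.
by rewrite linear_sum; apply: eq_bigr => j _; rewrite linearZ /= GE.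
Qed.

Lemma sw_lfun W W' (h : 'Hom(W, W')) (b : C -> C -> W) x :
  h (sw b x) = sw (fun u v => h (b u v)) x.
Proof. by apply: sw_morph => a u v; rewrite linearP. Qed.

Lemma sw_scale W a (b : C -> C -> W) x : a *: sw b x = sw (fun u v => a *: b u v) x.
Proof. by apply: sw_morph => l u v; rewrite scalerDr !scalerA mulrC. Qed.

Lemma sw_sum W (I : Type) (r : seq I) (b : I -> C -> C -> W) x :
  \sum_(i <- r) sw (b i) x = sw (fun u v => \sum_(i <- r) b i u v) x.
Proof.
under eq_bigr do rewrite swE; rewrite exchange_big swE; apply: eq_bigr => i _ /=.
by rewrite exchange_big; apply: eq_bigr => j _ /=; rewrite scaler_sumr.
Qed.

Lemma sw_exchange W (b : C -> C -> C -> C -> W) x y :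
  sw (fun u v => sw (b u v) y) x = sw (fun p q => sw (fun u v => b u v p q) x) y.
Proof.
rewrite [in LHS]swE [in RHS]swE.
transitivity (\sum_i \sum_j \sum_p \sum_q
   ((c i ** c j) x * (c p ** c q) y) *: b (e i) (e j) (e p) (e q)).
  apply: eq_bigr => i _; apply: eq_bigr => j _; rewrite swE scaler_sumr.
  by apply: eq_bigr => p _; rewrite scaler_sumr; apply: eq_bigr => q _; rewrite scalerA.
under eq_bigr do rewrite exchange_big /=.
rewrite exchange_big /=; apply: eq_bigr => p _.
under eq_bigr do rewrite exchange_big /=.
rewrite exchange_big /=; apply: eq_bigr => q _.
rewrite swE scaler_sumr; apply: eq_bigr => i _; rewrite scaler_sumr.
by apply: eq_bigr => j _; rewrite scalerA mulrC.
Qed.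

(** Coassociativity holds for every function g, since both sides evaluate it on
    the same triples of basis vectors, with coefficients given by triple
    convolution products of coordinates. *)
Lemma swA W (g : C -> C -> C -> W) x :
  sw (fun y z => sw (fun u v => g u v z) y) x =
  sw (fun y z => sw (fun u v => g y u v) z) x.
Proof.
transitivity (\sum_a \sum_b \sum_d (c a ** c b ** c d) x *: g (e a) (e b) (e d)).
  rewrite swE exchange_big /=.
  transitivity (\sum_d \sum_a \sum_b (c a ** c b ** c d) x *: g (e a) (e b) (e d)).
    apply: eq_bigr => d _; under eq_bigr do rewrite swE scaler_sumr.
    rewrite exchange_big; apply: eq_bigr => a _ /=.
    under eq_bigr do rewrite scaler_sumr.
    rewrite exchange_big; apply: eq_bigr => b _ /=.
    under eq_bigr do rewrite scalerA; rewrite -scaler_suml; congr (_ *: _).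
    rewrite -rhE (basisE (rh cC (c d) x)) linear_sum; apply: eq_bigr => i _.
    by rewrite linearZ /= rhE.
  rewrite exchange_big; apply: eq_bigr => a _ /=; rewrite exchange_big; apply: eq_bigr => b _ /=.
  by [].
rewrite swE; apply: eq_bigr => a _.
under [RHS]eq_bigr do rewrite swE scaler_sumr.
rewrite [RHS]exchange_big; apply: eq_bigr => b _ /=.
under [RHS]eq_bigr do rewrite scaler_sumr.
rewrite [RHS]exchange_big; apply: eq_bigr => d _ /=.
under [RHS]eq_bigr do rewrite scalerA; rewrite -scaler_suml; congr (_ *: _).
rewrite -convA -lhE (basisE (lh cC (c a) x)) linear_sum; apply: eq_bigr => i _.
by rewrite linearZ /= lhE.
Qed.

Lemma lh_sw f x : lh cC f x = sw (fun u v => f u *: v) x.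
Proof. exact: comp_lfunE. Qed.

Lemma rh_sw f x : rh cC f x = sw (fun u v => f v *: u) x.
Proof. exact: comp_lfunE. Qed.

Lemma conv_sw f g x : (f ** g) x = sw (fun u v => f u * g v : k^o) x.
Proof. exact: comp_lfunE. Qed.

Lemma sw_counitl W (g : C -> W) x : linear g -> sw (fun u v => eps u *: g v) x = g x.
Proof.
move=> /linear_lfun[G GE]; rewrite -GE -[in RHS](lh1 cC x) lh_sw sw_lfun.
by apply: sw_ext => u v; rewrite linearZ /= GE.
Qed.

Lemma sw_counitr W (g : C -> W) x : linear g -> sw (fun u v => eps v *: g u) x = g x.
Proof.
move=> /linear_lfun[G GE]; rewrite -GE -[in RHS](rh1 cC x) rh_sw sw_lfun.
by apply: sw_ext => u v; rewrite linearZ /= GE.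
Qed.

End Sweedler.

(** * The antipode is an anti-homomorphism *)

Section Hopf.
Variables (k : fieldType) (H : falgType k) (hH : hopf_algebra H).
Implicit Types (W : vectType k) (x y a b : H).
Local Notation eps := (counit hH).
Local Notation S := (antipode hH).
Local Notation sw := (sw hH).

Lemma sw_mull (g : H -> H -> H) a x : a * sw g x = sw (fun u v => a * g u v) x.
Proof. by apply: (sw_morph hH (h := fun w => a * w)) => l u v; rewrite mulrDr scalerAr. Qed.

Lemma sw_mulr (g : H -> H -> H) a x : sw g x * a = sw (fun u v => g u v * a) x.
Proof. by apply: (sw_morph hH (h := fun w => w * a)) => l u v; rewrite mulrDl scalerAl. Qed.

Lemma swZ (l : k) (g : H -> H -> H) x : l *: sw g x = sw (fun u v => l *: g u v) x.
Proof. exact: sw_scale. Qed.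

Lemma swZo (l : k) (g : H -> H -> k^o) x : l *: sw g x = sw (fun u v => l *: g u v) x.
Proof. exact: sw_scale. Qed.

Lemma swM W (g : H -> H -> W) x y :
    (forall v, linear (g^~ v)) -> (forall u, linear (g u)) ->
  sw g (x * y) = sw (fun x1 x2 => sw (fun y1 y2 => g (x1 * y1) (x2 * y2)) y) x.
Proof.
move=> gl gr; pose m := sw (fun a b => sw (fun c d => (a * c) ⊗ (b * d)) y) x.
have -> : sw g (x * y) = tlift g m by rewrite /sw comulM.
rewrite sw_lfun; apply: sw_ext => a b; rewrite sw_lfun; apply: sw_ext => c d.
by rewrite tliftE.
Qed.

Lemma sw_1 W (g : H -> H -> W) :
    (forall v, linear (g^~ v)) -> (forall u, linear (g u)) -> sw g 1 = g 1 1.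
Proof. by move=> gl gr; rewrite /sw comul1 tliftE. Qed.

Lemma antipode1 : S 1 = 1.
Proof.
have := antipodel hH 1; rewrite [LHS]sw_1 ?mulr1 ?counit1 ?scale1r //.
  by move=> v l u w /=; rewrite linearP mulrDl scalerAl.
by move=> u l v w /=; rewrite mulrDr scalerAr.
Qed.

Lemma sw_antipodel a b x : sw (fun u v => a * (S u * v) * b) x = eps x *: (a * b).
Proof.
by rewrite -sw_mulr -sw_mull [sw _ _]antipodel -scalerAr mulr1 -scalerAl.
Qed.

Lemma sw_antipoder a b x : sw (fun u v => a * (u * S v) * b) x = eps x *: (a * b).
Proof.
by rewrite -sw_mulr -sw_mull [sw _ _]antipoder -scalerAr mulr1 -scalerAl.
Qed.

Lemma counit_antipode x : eps (S x) = eps x.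
Proof.
have := congr1 eps (antipodel hH x); rewrite linearZ /= counit1 [_ *: 1]mulr1 => <-.
transitivity (sw (fun u v => eps v *: eps (S u)) x).
  by rewrite (sw_counitr hH (g := fun u => eps (S u))) // => l u v; rewrite !linearP.
by rewrite sw_lfun; apply: sw_ext => u v; rewrite counitM mulrC.
Qed.

(** In S(x_1 y_1) x_2 y_2 S(y_3) S(x_3), contracting y_2 S(y_3) and then x_2 S(x_3)
    leaves S(x y), while contracting S(x_1 y_1) x_2 y_2 leaves S(y) S(x). *)
Lemma antipodeM x y : S (x * y) = S y * S x.
Proof.
pose F x1 x2 x3 y1 y2 y3 : H := S (x1 * y1) * (x2 * y2) * (S y3 * S x3).
transitivity (sw (fun x1 x' => sw (fun x2 x3 =>
  sw (fun y1 y' => sw (F x1 x2 x3 y1) y') y) x') x).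
  transitivity (sw (fun x1 x' => eps x' *: S (x1 * y)) x).
    by rewrite (sw_counitr hH (g := fun u => S (u * y))) // => l u v; rewrite mulrDl -scalerAl linearP.
  apply: sw_ext => x1 x'.
  transitivity (sw (fun u v => S (x1 * y) * (u * S v) * 1) x'); first by rewrite sw_antipoder mulr1.
  apply: sw_ext => x2 x3; rewrite mulr1.
  transitivity (sw (fun y1 y' => eps y' *: (S (x1 * y1) * (x2 * S x3))) y).
    rewrite (sw_counitr hH (g := fun u => S (x1 * u) * (x2 * S x3))) // => l u v.
    by rewrite mulrDr -scalerAr linearP mulrDl scalerAl.
  apply: sw_ext => y1 y'.
  transitivity (sw (fun u v => (S (x1 * y1) * x2) * (u * S v) * S x3) y').
    by rewrite sw_antipoder !mulrA.
  by apply: sw_ext => y2 y3; rewrite /F !mulrA.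
transitivity (sw (fun p x3 => sw (fun q y3 => eps (p * q) *: (S y3 * S x3)) y) x); last first.
  transitivity (sw (fun p x3 => eps p *: (S y * S x3)) x).
    apply: sw_ext => p x3.
    transitivity (eps p *: sw (fun q y3 => eps q *: (S y3 * S x3)) y).
      by rewrite swZ; apply: sw_ext => q y3; rewrite counitM scalerA.
    congr (_ *: _); rewrite (sw_counitl hH (g := fun u => S u * S x3)) // => l u v.
    by rewrite linearP mulrDl scalerAl.
  rewrite (sw_counitl hH (g := fun u => S y * S u)) // => l u v.
  by rewrite linearP mulrDr scalerAr.
rewrite -swA; apply: sw_ext => p x3.
transitivity (sw (fun x1 x2 => sw (fun q y3 => sw (fun y1 y2 => F x1 x2 x3 y1 y2 y3) q) y) p).
  by apply: sw_ext => x1 x2; rewrite swA.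
transitivity (sw (fun q y3 => sw (fun x1 x2 => sw (fun y1 y2 => F x1 x2 x3 y1 y2 y3) q) p) y).
  transitivity (sw (fun x1 x2 => sw (fun q y3 => (fun x1 x2 q y3 =>
     sw (fun y1 y2 => F x1 x2 x3 y1 y2 y3) q) x1 x2 q y3) y) p); first by [].
  by rewrite sw_exchange.
apply: sw_ext => q y3.
transitivity (sw (fun u v => 1 * (S u * v) * (S y3 * S x3)) (p * q)); last first.
  by rewrite sw_antipodel mul1r.
rewrite swM; last 2 first.
- by move=> v l u w; rewrite !mul1r linearP mulrDl mulrDl -!scalerAl.
- by move=> v l u w; rewrite !mul1r mulrDr mulrDl -?scalerAl -?scalerAr -?scalerAl.
by apply: sw_ext => x1 x2; apply: sw_ext => y1 y2; rewrite mul1r.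
Qed.

(** For u_1, u_2 the components of the coproduct of S(x_1), the sum of
    f(u_1 x_2 S(x_5)) g(u_2 x_3 S(x_4)) contracts on the right to (f ** g)(S x),
    and on the left, where u and x_2, x_3 combine to the coproduct of
    S(x_1) x_2, to g(S x_1) f(S x_2). *)
Lemma antipode_antihom : coalg_antihom hH S.
Proof.
move=> f g; apply/lfunP => x; rewrite comp_lfunE conv_sw [RHS]conv_sw.
pose G a b u v : k^o := f (u * a) * g (v * b).
have Gl a b v : linear ((G a b)^~ v).
  by move=> l u w; rewrite /G mulrDl -scalerAl linearP mulrDl -mulrA.
have Gr a b u : linear (G a b u).
  by move=> l v w; rewrite /G mulrDl -scalerAl linearP mulrDr mulrCA.
pose F x1 x2 x3 x4 x5 : k^o := sw (G (x2 * S x5) (x3 * S x4)) (S x1).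
transitivity (sw (fun x1 r => sw (fun x2 r => sw (fun x3 r => sw (F x1 x2 x3) r) r) r) x).
  transitivity (sw (fun x1 r => eps r *: sw (G 1 1) (S x1)) x).
    rewrite (sw_counitr hH (g := fun u => sw (G 1 1) (S u))) => [|l u v]; last by rewrite linearP sw_linear.
    by apply: sw_ext => u v; rewrite /G !mulr1.
  apply: sw_ext => x1 r; rewrite swZo.
  transitivity (sw (fun u v => sw (fun x2 x5 => G (x2 * S x5) 1 u v) r) (S x1)).
    apply: sw_ext => u v.
    transitivity ((f (sw (fun x2 x5 => u * (x2 * S x5) * 1) r)) * g v : k^o).
      by rewrite sw_antipoder !mulr1 /G !mulr1 [LHS]scalerAl linearZ.
    rewrite sw_lfun [LHS]mulrC; transitivity (g v *: sw (fun x2 x5 => f (u * (x2 * S x5) * 1)) r); first by [].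
    by rewrite swZo; apply: sw_ext => x2 x5; rewrite /G !mulr1 mulrC.
  rewrite sw_exchange.
  transitivity (sw (fun x2 r => sw (fun p x5 => eps p *: sw (G (x2 * S x5) 1) (S x1)) r) r).
    apply: sw_ext => x2 r2.
    rewrite (sw_counitl hH (g := fun x5 => sw (G (x2 * S x5) 1) (S x1))) //.
    apply: sw_linear_arg => u v l x5 x5'; rewrite /G linearP mulrDr -scalerAr.
    by rewrite mulrDr -scalerAr linearP mulrDl -scalerAl.
  apply: sw_ext => x2 r2; rewrite -swA; apply: sw_ext => p x5.
  rewrite swZo /F sw_exchange; apply: sw_ext => u v.
  transitivity (f (u * (x2 * S x5)) *: (g (sw (fun x3 x4 => v * (x3 * S x4) * 1) p)) : k^o).
    rewrite sw_antipoder !mulr1 /G mulr1.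
    by have -> : g (eps p *: v) = eps p * g v; [rewrite linearZ | apply: mulrCA].
  by rewrite (sw_lfun hH g) swZo; apply: sw_ext => x3 x4; rewrite mulr1.
transitivity (sw (fun x1 r => sw (fun p r' => sw (fun x2 x3 => sw (F x1 x2 x3) r') p) r) x).
  by apply: sw_ext => x1 r; rewrite swA.
rewrite -swA.
transitivity (sw (fun q r' => eps q *: sw (fun x4 x5 => g (S x4) * f (S x5) : k^o) r') x); last first.
  rewrite (sw_counitl hH (g := sw _)); last exact: sw_linear.
  by apply: sw_ext => u v; rewrite !comp_lfunE.
apply: sw_ext => q r; rewrite swZo.
transitivity (sw (fun x1 p => sw (fun x4 x5 => sw (fun x2 x3 => F x1 x2 x3 x4 x5) p) r) q).
  by apply: sw_ext => x1 p; rewrite sw_exchange.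
rewrite sw_exchange; apply: sw_ext => x4 x5.
transitivity (sw (fun x1 p => sw (G (S x5) (S x4)) (S x1 * p)) q).
  apply: sw_ext => x1 p; rewrite swM // sw_exchange; apply: sw_ext => u v.
  by apply: sw_ext => x2 x3; rewrite /G !mulrA.
transitivity (sw (G (S x5) (S x4)) (sw (fun x1 p => S x1 * p) q)).
  by rewrite [RHS](sw_morph hH (h := sw _)) //; apply: sw_linear.
by rewrite [sw _ q]antipodel swZr sw_1 // /G !mul1r mulrC.
Qed.

End Hopf.

(** * Bijectivity of the antipode, and integrals *)

Section Integral.
Variables (k : fieldType) (H : falgType k) (hH : hopf_algebra H).
Implicit Types (W : vectType k) (x y a b h m : H) (f g : 'Hom(H, k^o)).
Local Infix "**" := (conv hH) (at level 40, left associativity).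
Local Notation eps := (counit hH).
Local Notation S := (antipode hH).
Local Notation sw := (sw hH).
Local Notation lh := (lh hH).
Local Notation rh := (rh hH).

(** The linear maps from H to the subalgebra S(H) are a finite-dimensional algebra
    under convolution which contains S.  As S is invertible under convolution,
    multiplication by S is injective on this algebra, hence surjective; so the
    inverse of S, which is the identity map, has its values in S(H). *)
Lemma antipode_surj : limg S = fullv.
Proof.
pose B := limg S.
have BM a b : a \in B -> b \in B -> a * b \in B.
  move=> /memv_imgP[u _ ->] /memv_imgP[v _ ->].
  by rewrite -antipodeM memv_img ?memvf.
have [P PE] : exists P : 'Hom('End(H), 'End(H)), forall F, P F = ((\1 - projv B) \o F)%VF.
  by apply: linear_lfun => l F G; rewrite comp_lfunDr comp_lfunZr.
have [cS cSE] : exists L : 'Hom('End(H), 'End(H)), forall F x, L F x = sw (fun u v => S u * F v) x.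
  have pt F : exists G : 'End(H), forall x, G x = sw (fun u v => S u * F v) x.
    by apply: linear_lfun; apply: sw_linear.
  have [L LE] := choice pt; have [M ME] : exists M : 'Hom('End(H), 'End(H)), forall F, M F = L F.
    apply: linear_lfun => l F G; apply/lfunP => x; rewrite add_lfunE scale_lfunE !LE.
    apply: (sw_linear_arg hH (b := fun F u v => S u * (F : 'End(H)) v)) => u v l' F' G'.
    by rewrite add_lfunE scale_lfunE mulrDr scalerAr.
  by exists M => F x; rewrite ME LE.
pose W := lker P.
have memW F : (F \in W) <-> (forall x, F x \in B).
  rewrite memv_ker PE; split=> [/eqP F0 x|FB].
    have := congr1 (fun G : 'End(H) => G x) F0; rewrite comp_lfunE add_lfunE opp_lfunE id_lfunE lfunE /=.
    by move/eqP; rewrite subr_eq0 => /eqP->; rewrite memv_proj.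
  apply/eqP/lfunP => x; rewrite comp_lfunE add_lfunE opp_lfunE id_lfunE lfunE /=.
  by rewrite projv_id ?FB // subrr.
have cSK F x : sw (fun u v => u * cS F v) x = F x.
  transitivity (sw (fun u v => eps u *: F v) x); last first.
    by rewrite (sw_counitl hH (g := F)) // => l u v; rewrite linearP.
  transitivity (sw (fun u v => sw (fun p q => u * (S p * F q)) v) x).
    by apply: sw_ext => u v; rewrite cSE sw_mull.
  rewrite -swA; apply: sw_ext => u v.
  transitivity (sw (fun p q => 1 * (p * S q) * F v) u); first by apply: sw_ext => p q; rewrite mul1r mulrA.
  by rewrite sw_antipoder mul1r.
have cS0 : (W :&: lker cS)%VS = 0%VS.
  apply/eqP; rewrite -subv0; apply: subv_trans (capvSr _ _) _; apply/subvP => F.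
  rewrite memv_ker memv0 => /eqP F0; apply/eqP/lfunP => x; rewrite -cSK F0 zero_lfunE.
  by rewrite swE big1 // => i _; rewrite big1 // => j _; rewrite zero_lfunE mulr0 scaler0.
have cSW : (cS @: W <= W)%VS.
  apply/subvP => _ /memv_imgP[F /memW FB ->]; apply/memW => x; rewrite cSE swE.
  apply: memv_suml => i _; apply: memv_suml => j _; rewrite memvZ // BM //.
  by rewrite memv_img ?memvf.
have EW : (cS @: W)%VS = W by apply/eqP; rewrite eqEdim cSW limg_dim_eq // leqnn.
have [U UE] : exists U : 'End(H), forall x, U x = eps x *: 1.
  by apply: linear_lfun => l u v; rewrite linearP scalerDl scalerA.
have : U \in W.
  apply/memW => x; rewrite UE memvZ // -(antipode1 hH) memv_img ?memvf //.
rewrite -EW => /memv_imgP[F /memW FB UF].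
apply/eqP; rewrite eqEsubv subvf; apply/subvP => x _.
suff -> : x = F x by apply: FB.
rewrite -cSK -UF; transitivity (sw (fun u v => eps v *: u) x).
  by rewrite (sw_counitr hH (g := id)).
by apply: sw_ext => u v; rewrite UE -scalerAr mulr1.
Qed.

Lemma antipode_inj : lker S == 0%VS.
Proof.
have := limg_ker_dim S fullv; rewrite antipode_surj capfv -dimv_eq0.
by rewrite -[X in _ = X]add0n => /eqP; rewrite eqn_add2r.
Qed.

Let e (i : 'I_(\dim {:H})) : H := (vbasis {:H})`_i.
Let c (i : 'I_(\dim {:H})) : 'Hom(H, k^o) := linfun (coord (vbasis {:H}) i : H -> k^o).

Let basisE x : x = \sum_i c i x *: e i.
Proof. by rewrite {1}(coord_vbasis (memvf x)); apply: eq_bigr => i _; rewrite lfunE. Qed.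

Definition trace (X : 'End(H)) : k^o := \sum_i c i (X (e i)).

Lemma trace_comm (X Y : 'End(H)) : trace (X \o Y)%VF = trace (Y \o X)%VF.
Proof.
have E (X1 Y1 : 'End(H)) : trace (X1 \o Y1)%VF = \sum_i \sum_j c i (X1 (e j)) * c j (Y1 (e i)).
  apply: eq_bigr => i _; rewrite comp_lfunE {1}(basisE (Y1 (e i))) !linear_sum.
  by apply: eq_bigr => j _; rewrite !linearZ /= mulrC.
rewrite !E exchange_big; apply: eq_bigr => i _; apply: eq_bigr => j _; exact: mulrC.
Qed.

Let s2 m f x : H := S (S (lh f x)) * m.

Let s2_lfun m f : exists K : 'End(H), forall x, K x = s2 m f x.
Proof. by apply: linear_lfun => l u v; rewrite /s2 !linearP mulrDl scalerAl. Qed.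

(** The vector is t = sum_i e_i1 c_i(S^2(e_i2) m).  It is what remains of the
    invariant vector of H (x) H^* given by dual bases when this module is made free
    through h (x) f |-> h_1 (x) S(h_2) f and f is evaluated at m.  Its functionals
    are traces, so its invariance follows from cyclicity. *)
Lemma trace_vector m : exists t,
  forall f (K : 'End(H)), (forall x, K x = s2 m f x) -> f t = trace K.
Proof.
pose g i : 'Hom(H, k^o) := (c i \o amulr m \o S \o S)%VF.
have gE i x : g i x = c i (S (S x) * m) by rewrite !comp_lfunE [amulr _ _]lfunE.
exists (\sum_i rh (g i) (e i)) => f K KE; rewrite linear_sum; apply: eq_bigr => i _.
by rewrite /= KE rhE -lhE gE.
Qed.

Definition left_integral t := forall h, h * t = eps h *: t.

Let s2_sw m f x : s2 m f x = sw (fun u v => f u *: (S (S v) * m)) x.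
Proof.
rewrite /s2 lh_sw !sw_lfun sw_mulr; apply: sw_ext => u v.
by rewrite !linearZ /= scalerAl.
Qed.

Let antipodeZ1 (l : k) : S (l *: 1) = l *: 1.
Proof. by rewrite linearZ /= antipode1. Qed.

(** Insert S(S(h_2) h_3) = S(h_3) S^2(h_2), which contracts to the counit. *)
Let s2_shift m f h x :
  s2 m (f \o amull h)%VF x = sw (fun h1 h2 => S h2 * s2 m f (h1 * x)) h.
Proof.
have mulE y z : amull y z = y * z by rewrite lfunE.
transitivity (sw (fun a r => (eps r : k) *: sw (fun u v => (f (a * u) : k) *: (S (S v) * m)) x) h).
  rewrite (sw_counitr hH (g := fun a => sw (fun u v => (f (a * u) : k) *: (S (S v) * m)) x)).
    by rewrite s2_sw; apply: sw_ext => u v; rewrite comp_lfunE mulE.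
  apply: sw_linear_arg => u v l a b.
  by rewrite mulrDl -scalerAl linearP scalerDl scalerA.
transitivity (sw (fun a r => sw (fun b h2 =>
    sw (fun u v => (f (a * u) : k) *: (S (S b * h2) * (S (S v) * m))) x) r) h).
  apply: sw_ext => a r; rewrite sw_exchange swZ; apply: sw_ext => u v.
  transitivity ((f (a * u) : k) *: (S (sw (fun b h2 => S b * h2) r) * (S (S v) * m))).
    rewrite [sw _ r]antipodel antipodeZ1 -scalerAl mul1r.
    by rewrite !scalerA mulrC.
  by rewrite sw_lfun sw_mulr swZ.
rewrite -swA; apply: sw_ext => h1 h2.
rewrite s2_sw swM.
- rewrite sw_mull; apply: sw_ext => a b; rewrite sw_mull; apply: sw_ext => u v.
  by rewrite !antipodeM -scalerAr !mulrA.
- by move=> v l u w; rewrite linearP scalerDl scalerA.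
by move=> u l v w; rewrite !linearP mulrDl scalerDr -scalerAl !scalerA mulrC.
Qed.

Let trace_linear : linear trace.
Proof.
move=> l X Y; rewrite /trace scaler_sumr -big_split; apply: eq_bigr => i _ /=.
by rewrite add_lfunE scale_lfunE linearP.
Qed.

(** In f(h t), the trace of s2 shifts h_1 to one side and S(h_2) to the other
    ([s2_shift]); cyclicity brings them together as h_1 S(h_2). *)
Lemma trace_vector_integral m t :
  (forall f (K : 'End(H)), (forall x, K x = s2 m f x) -> f t = trace K) -> left_integral t.
Proof.
move=> tE h; apply: functional_sep => f; rewrite linearZ /=.
have mulE y z : amull y z = y * z by rewrite lfunE.
have [K KE] := s2_lfun m f; rewrite (tE f K) //.
have [K' K'E] := s2_lfun m (f \o amull h)%VF.
transitivity (trace K'); first by rewrite -(tE _ K' K'E) comp_lfunE mulE.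
transitivity (sw (fun h1 h2 => trace (amull (S h2) \o (K \o amull h1))%VF) h).
  rewrite -(sw_sum hH); apply: eq_bigr => i _.
  rewrite K'E s2_shift sw_lfun; apply: sw_ext => h1 h2.
  by rewrite !comp_lfunE !mulE KE.
transitivity (sw (fun h1 h2 => trace (K \o amull (h1 * S h2))%VF) h).
  by apply: sw_ext => h1 h2; rewrite trace_comm -comp_lfunA amullM.
have T_lin : linear (fun y => trace (K \o amull y)%VF).
  by move=> l u v; rewrite linearP comp_lfunDr -comp_lfunZr trace_linear.
rewrite -(sw_morph hH (h := fun y => trace (K \o amull y)%VF)) // [sw _ h]antipoder.
have [T TE] := linear_lfun T_lin; rewrite -TE linearZ /= TE.
by congr (_ *: trace _); apply/lfunP => x; rewrite comp_lfunE mulE mul1r.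
Qed.

(** If all vectors of [trace_vector] were zero, undoing the isomorphism that
    produces them would kill the dual bases element: for all f and y, the sum of
    f(e_i1) c_i(S^2(e_i3) S(e_i2) y) is both zero and f(y). *)
Theorem left_integral_ex : exists2 t, t != 0 & left_integral t.
Proof.
have [t tE] := choice trace_vector.
have [[m nzt]|no] := pselect (exists m, t m != 0).
  by exists (t m) => //; apply: trace_vector_integral (tE m).
have t0 m : t m = 0 by apply/eqP; apply: contrapT => /negP nz; apply: no; exists m.
suff : 1 = 0 :> H by move/eqP; rewrite oner_eq0.
apply: functional_sep => f; rewrite linear0.
have fy (y : H) : \sum_i f (e i) * c i y = 0.
  pose q j : 'Hom(H, k^o) := (c j \o amulr y \o S)%VF.
  have qE j x : q j x = c j (S x * y) by rewrite !comp_lfunE [amulr _ _]lfunE.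
  transitivity (\sum_j (f ** q j) (t (e j))); last first.
    by rewrite big1 // => j _; rewrite t0 linear0.
  have sE j : (f ** q j) (t (e j)) = \sum_i c i (s2 (e j) (f ** q j) (e i)).
    have [K KE] := s2_lfun (e j) (f ** q j).
    by rewrite (tE _ _ K) //; apply: eq_bigr => i _; rewrite KE.
  under [RHS]eq_bigr do rewrite sE.
  rewrite exchange_big; apply: eq_bigr => i _ /=; rewrite -linear_sum /=.
  transitivity (c i (eps (lh f (e i)) *: y)).
    by rewrite linearZ /= lhE conv1r.
  congr (c i _); set z := lh f (e i).
  transitivity (sw (fun u v => S (S v) * (S u * y)) z); last first.
    transitivity (\sum_j sw (fun u v => q j u *: (S (S v) * e j)) z).
      rewrite sw_sum; apply: sw_ext => u v; rewrite [S u * y]basisE mulr_sumr.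
      by apply: eq_bigr => j _; rewrite qE scalerAr.
    by apply: eq_bigr => j _; rewrite -s2_sw /s2 /z lh_lh.
  transitivity (S (sw (fun u v => u * S v) z) * y).
    by rewrite [sw _ z]antipoder antipodeZ1 -scalerAl mul1r.
  by rewrite sw_lfun sw_mulr; apply: sw_ext => u v; rewrite antipodeM mulrA.
by rewrite {1}(basisE 1) linear_sum -[RHS](fy 1); apply: eq_bigr => i _; rewrite linearZ mulrC.
Qed.

Section Nondegenerate.
Variable t : H.
Hypothesis t_int : left_integral t.

(** The formula t_1 f(h t_2) = S(h_1) h_2 t_1 f(h_3 t_2). *)
Let rh_shift f h :
  rh (f \o amull h)%VF t = sw (fun a b => S a * rh f (b * t)) h.
Proof.
have mulE y z : amull y z = y * z by rewrite lfunE.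
transitivity (sw (fun p b => (eps p : k) *: sw (fun u v => (f (b * v) : k) *: u) t) h).
  rewrite (sw_counitl hH (g := fun b => sw (fun u v => (f (b * v) : k) *: u) t)).
    by rewrite rh_sw; apply: sw_ext => u v; rewrite comp_lfunE mulE.
  apply: sw_linear_arg => u v l a b.
  by rewrite mulrDl -scalerAl linearP scalerDl scalerA.
transitivity (sw (fun p b => sw (fun a a' => sw (fun u v => (f (b * v) : k) *: (S a * a' * u)) t) p) h).
  apply: sw_ext => p b; rewrite sw_exchange swZ; apply: sw_ext => u v.
  transitivity ((f (b * v) : k) *: (sw (fun a a' => S a * a') p * u)).
    by rewrite [sw _ p]antipodel -scalerAl mul1r !scalerA mulrC.
  by rewrite sw_mulr swZ.
rewrite swA; apply: sw_ext => a r.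
rewrite rh_sw swM.
- rewrite sw_mull; apply: sw_ext => u b; rewrite sw_mull; apply: sw_ext => v w.
  by rewrite -scalerAr mulrA.
- by move=> v l u w; rewrite scalerDr !scalerA mulrC.
by move=> u l v w; rewrite linearP scalerDl scalerA.
Qed.

(** The functionals f with t_1 f(t_2) = 0 form a left ideal, which is stable under
    f |-> f(h -) by [rh_shift].  Hence it contains f(1) eps, which is the map
    x |-> f(S(x_1) x_2), and f(1) = 0; apply this to all the f(h -). *)
Lemma left_integral_nondeg f : t != 0 -> rh f t = 0 -> f = 0.
Proof.
move=> nzt; have mulE y z : amull y z = y * z by rewrite lfunE.
have shift g h : rh g t = 0 -> rh (g \o amull h)%VF t = 0.
  move=> g0; rewrite rh_shift swE big1 // => i _; rewrite big1 // => j _.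
  by rewrite t_int linearZ /= g0 scaler0 mulr0 scaler0.
have at1 g : rh g t = 0 -> g 1 = 0.
  move=> g0; have : rh (g 1 *: eps) t = 0.
    have -> : g 1 *: eps = \sum_i (c i \o S)%VF ** (g \o amull (e i))%VF.
      apply/lfunP => x; rewrite scale_lfunE sum_lfunE.
      transitivity (g (sw (fun u v => S u * v) x)).
        by rewrite [sw _ x]antipodel linearZ; apply: mulrC.
      rewrite (eq_bigr (fun i => sw (fun u v => (c i \o S)%VF u * (g \o amull (e i))%VF v : k^o) x)) => [|i _];
        last exact: conv_sw.
      rewrite sw_sum sw_lfun; apply: sw_ext => u v.
      rewrite {1}(basisE (S u)) mulr_suml linear_sum; apply: eq_bigr => i _.
      by rewrite !comp_lfunE mulE -scalerAl linearZ.
    apply: functional_sep => q; rewrite linear0 rhE conv_sumr sum_lfunE big1 // => i _.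
    by rewrite convA -rhE shift ?linear0.
  have -> : rh (g 1 *: eps) t = g 1 *: t.
    by apply: functional_sep => q; rewrite rhE convZr conv1r scale_lfunE linearZ.
  by move/eqP; rewrite scaler_eq0 (negPf nzt) orbF => /eqP.
move=> f0; apply/lfunP => h; have := at1 _ (shift f h f0).
by rewrite comp_lfunE mulE mulr1 zero_lfunE.
Qed.

End Nondegenerate.
End Integral.

(** * From layers to links *)

Section Coactions.
Variables (k : fieldType) (C : vectType k) (cC : coalgebra C) (p : 'End(C)).
Implicit Types (f g : 'Hom(C, k^o)) (x : C) (D E S N : {vspace C}).
Local Infix "**" := (conv cC) (at level 40, left associativity).
Local Notation lh := (lh cC).
Local Notation rh := (rh cC).

Lemma tpair_rhoL f g x : tpair f g (rhoL cC p x) = ((f \o p)%VF ** g) x.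
Proof. by rewrite comp_lfunE tpair_tmap comp_lfun1r convE. Qed.

Lemma tpair_rhoR f g x : tpair f g (rhoR cC p x) = (f ** (g \o p)%VF) x.
Proof. by rewrite comp_lfunE tpair_tmap comp_lfun1r convE. Qed.

Lemma lh_rhoL f x : lh (f \o p)%VF x = slicel C f (rhoL cC p x).
Proof. by apply: functional_sep => g; rewrite lhE -tpair_rhoL tpair_slicel. Qed.

Lemma rh_rhoR f x : rh (f \o p)%VF x = slicer C f (rhoR cC p x).
Proof. by apply: functional_sep => g; rewrite rhE -tpair_rhoR tpair_slicer. Qed.

Lemma subbicomodP N : subbicomod cC p N ->
  (forall f x, x \in N -> lh (f \o p)%VF x \in N) /\
  (forall f x, x \in N -> rh (f \o p)%VF x \in N).
Proof.
case/andP => /subvP NL /subvP NR; split=> f x xN.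
  by rewrite lh_rhoL; apply: slicel_tensv (NL _ (memv_img _ xN)).
by rewrite rh_rhoR; apply: slicer_tensv (NR _ (memv_img _ xN)).
Qed.

(** Slicing the coaction of V^* at v gives the slice of the coaction of v at g. *)
Lemma dual_coact_tensv D (V : vectType k) (rV : 'Hom(V, tens V C)) (g : 'Hom(V, k^o)) :
  (limg rV <= tensv fullv D)%VS -> dual_coact rV g \in tensv D fullv.
Proof.
move=> /subvP rVD; apply: mem_tensv => [f|F]; first exact: memvf.
have [v Fv] := dual_eval F.
have -> : slicer C F (dual_coact rV g) = slicel C g (rV v).
  rewrite -[RHS]dual_coactE; congr (fun_of_lfun (tlift _) _).
  by apply/funext => c; apply/funext => h; rewrite Fv.
by apply: slicel_tensv (rVD _ _); rewrite memv_img ?memvf.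
Qed.

Lemma of_type_support D E S x : of_type cC p D E S -> x \in S ->
  rhoL cC p x \in tensv D fullv /\ rhoR cC p x \in tensv fullv E.
Proof.
move=> [V [W [rV [rW [f [[_ rVD _ _] [_ rWE _ _] [_ <-] fL fR]]]]]] /memv_imgP[y _ ->].
rewrite fL fR; split.
  rewrite (tpureE y) !linear_sum; apply: memv_suml => i _; rewrite !linear_sum.
  apply: memv_suml => j _; rewrite !linearZ memvZ //= comp_lfunE tmapE id_lfunE.
  set g := _`_i; set w := _`_j; have [L LE] := linear_lfun (@tpure_linearl k (tens C (dual V)) W w).
  have dcD := dual_coact_tensv g rVD.
  pose G := (tmap \1%VF f \o tassoc C (dual V) W \o L)%VF.
  rewrite -LE (_ : tmap _ _ _ = G (dual_coact rV g)); last by rewrite !comp_lfunE.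
  apply: tensv_map dcD => a h aD _.
  by rewrite /= !comp_lfunE LE tassoc_pure tmapE id_lfunE memv_tens // memvf.
rewrite (tpureE y) !linear_sum; apply: memv_suml => i _; rewrite !linear_sum.
apply: memv_suml => j _; rewrite !linearZ memvZ //= comp_lfunE tmapE id_lfunE.
set g := _`_i; set w := _`_j.
have rwE : rW w \in tensv fullv E by apply: (subvP rWE); rewrite memv_img ?memvf.
have [L LE] := linear_lfun (@tpure_linearr k (dual V) (tens W C) g).
pose G := (tmap f \1%VF \o tassoc_inv (dual V) W C \o L)%VF.
rewrite -LE (_ : tmap _ _ _ = G (rW w)); last by rewrite !comp_lfunE.
apply: tensv_map rwE => v c _ cE.
by rewrite /= !comp_lfunE LE tassoc_inv_pure tmapE id_lfunE memv_tens // memvf.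
Qed.

End Coactions.

Section Bridge.
Variables (k : closedFieldType) (C : vectType k) (cC : coalgebra C).
Implicit Types (f g e : 'Hom(C, k^o)) (x y : C) (D E N Q S X : {vspace C}).
Local Infix "**" := (conv cC) (at level 40, left associativity).
Local Notation eps := (counit cC).
Local Notation lh := (lh cC).
Local Notation rh := (rh cC).
Local Notation C0 := (coradical cC).
Local Notation CF := (corad_filt cC).
Local Notation simple := (simple_subcoalg cC).

Variable p : 'End(C).
Hypothesis pP : coalg_proj cC p.

Let pC0 x : p x \in C0. Proof. by case: pP => <- _ _ _; rewrite memv_img ?memvf. Qed.
Let p_id x : x \in C0 -> p x = x. Proof. by case: pP => _ + _ _; apply. Qed.

Lemma proj_ext f g : ann C0 (f - g) -> (f \o p = g \o p)%VF.
Proof. by move=> fg; apply/lfunP => x; rewrite !comp_lfunE; apply: ann_sub fg _ (pC0 x). Qed.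

Lemma conv_proj f g : ((f ** g) \o p = (f \o p) ** (g \o p))%VF.
Proof.
apply/lfunP => x; rewrite comp_lfunE !convE; case: pP => _ _ -> _.
by rewrite tpair_tmap.
Qed.

Lemma counit_proj : (eps \o p)%VF = eps.
Proof. by apply/lfunP => x; rewrite comp_lfunE; case: pP => _ _ _ ->. Qed.

Lemma indicator_proj D e : simple D -> indicator cC D e -> indicator cC D (e \o p)%VF.
Proof.
move=> sD [eD eE]; split=> [x xD|F sF FD x xF]; rewrite comp_lfunE p_id.
- exact: eD.
- exact: subvP (simple_sub_coradical sD) _ xD.
- exact: eE xF.
exact: subvP (simple_sub_coradical sF) _ xF.
Qed.

Lemma indicator_proj_idem D e : simple D -> indicator cC D e ->
  ((e \o p) ** (e \o p) = e \o p)%VF.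
Proof. by move=> sD De; rewrite -conv_proj; apply/proj_ext/(indicator_id sD De). Qed.

Lemma lh_proj_id D e x : simple D -> indicator cC D e ->
  rhoL cC p x \in tensv D fullv -> lh (e \o p)%VF x = x.
Proof.
move=> sD [eD _] xD; apply: functional_sep => g; rewrite lhE -tpair_rhoL tpair_slicer.
by rewrite eD ?(slicer_tensv _ xD) // -tpair_slicer tpair_rhoL counit_proj conv1l.
Qed.

Lemma rh_proj_id E e x : simple E -> indicator cC E e ->
  rhoR cC p x \in tensv fullv E -> rh (e \o p)%VF x = x.
Proof.
move=> sE [eE _] xE; apply: functional_sep => g; rewrite rhE -tpair_rhoR tpair_slicel.
by rewrite eE ?(slicel_tensv _ xE) // -tpair_slicel tpair_rhoR counit_proj conv1r.
Qed.

Section Layer.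
Variables (n : nat) (Q : {vspace C}).
Hypothesis Q_add : (filt_ker cC p n + Q)%VS = filt_ker cC p n.+1.
Hypothesis Q_cap : (filt_ker cC p n :&: Q)%VS = 0%VS.

(** A vector x of S is fixed by the indicators of D and E on both sides, when these
    are taken to factor through p.  As x is not in C_n, some a in J^(n+1) has
    a(x) nonzero, and a(x) = (e ** a ** e')(x). *)
Lemma layer_link D E S : simple D -> simple E -> of_type cC p D E S ->
  (S <= Q)%VS -> S != 0%VS -> link cC n D E.
Proof.
move=> sD sE SDE /subvP SQ nzS; pose x := vpick S; have xS : x \in S := memv_pick S.
have xQ := SQ _ xS; have nzx : x != 0 by rewrite vpick0.
have xF : x \in filt_ker cC p n.+1 by rewrite -Q_add (subvP (addvSr _ _)).
have [xC xI] : x \in CF n.+1 /\ x \in lker p by apply/andP; rewrite -memv_cap.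
have nxC : x \notin CF n.
  by apply: contra nzx => xCn; rewrite -memv0 -Q_cap !memv_cap xCn xI.
have [a aA nza] : exists2 a : 'Hom(C, k^o), ann (CF n) a & a x != 0.
  apply: contrapT => no; case/negP: nxC; apply: ann_sep => a aA; apply/eqP.
  by apply: contrapT => /negP nz; apply: no; exists a.
have [e De] := indicator_ex sD; have [e' Ee'] := indicator_ex sE.
have [xD xE] := of_type_support SDE xS.
apply: (link_indep sD sE (indicator_proj sD De) (indicator_proj sE Ee')).
exists a, x; split=> //.
by rewrite -rhE -lhE (rh_proj_id sE Ee' xE) (lh_proj_id sD De xD).
Qed.

End Layer.

(** The dual family of a comatrix basis, extended by zero to the other components
    and along p.  The products with functionals f \o p then obey the rules of
    matrix units exactly and not only modulo J. *)
Lemma matrix_units D : simple D ->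
  exists d (c : 'I_d -> 'I_d -> C) phi (U : 'I_d -> 'I_d -> 'Hom(C, k^o)),
  [/\ (0 < d)%N, comatrix_basis cC c phi, D = cspan c,
      indicator cC D (\sum_i U i i)
    & [/\ forall i j, (U i j \o p)%VF = U i j,
      forall f i j, U i j ** (f \o p)%VF = \sum_b f (c j b) *: U i b
    & forall f i j, (f \o p)%VF ** U i j = \sum_a f (c a i) *: U a j]].
Proof.
move=> sD; have [d [c [phi [d_gt0 cb Dc]]]] := simple_comatrix sD.
have [e De] := indicator_ex sD; have [eD eF] := De; have [cM ceps dualP] := cb.
pose u i j := e ** phi i j; pose U i j := (u i j \o p)%VF.
have u0 F i j : simple F -> F <> D -> ann F (u i j).
  by move=> sF FD; apply: ann_convl (eF F sF FD); case: sF.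
have uc i j a b : u i j (c a b) = ((i == a) && (j == b))%:R.
  rewrite cM (bigD1 a) //= eD ?Dc ?mem_cspan // ceps eqxx mul1r dualP.
  rewrite big1 ?addr0 // => l la.
  by rewrite eD ?Dc ?mem_cspan // ceps eq_sym (negPf la) mul0r.
have on_D f g : (forall i j, f (c i j) = g (c i j)) ->
    (forall F, simple F -> F <> D -> ann F f /\ ann F g) -> (f \o p = g \o p)%VF.
  move=> fgD fgF; apply/proj_ext/ann_coradical => F sF x xF.
  rewrite add_lfunE opp_lfunE; have [FD|FD] := pselect (F = D).
    by rewrite (cspan_ext (f := f) (g := g) (c := c)) -?Dc -?FD ?subrr.
  by have [-> // ->] := fgF F sF FD; rewrite ?subrr.
have sum_proj (I : finType) (l : I -> k) (g : I -> 'Hom(C, k^o)) :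
    ((\sum_i l i *: g i) \o p = \sum_i l i *: (g i \o p))%VF.
  apply/lfunP => x; rewrite comp_lfunE !sum_lfunE; apply: eq_bigr => i _.
  by rewrite !scale_lfunE comp_lfunE.
exists d, c, phi, U; split=> //; last split=> [i j|f|f].
- have -> : \sum_i U i i = (e \o p)%VF; last exact: indicator_proj.
  have <- : (\sum_i 1 *: (u i i \o p) = \sum_i U i i)%VF.
    by apply: eq_bigr => i _; rewrite scale1r.
  rewrite -sum_proj; apply: on_D => [a b|F sF FD].
    rewrite sum_lfunE (bigD1 a) //= scale1r uc eqxx /= big1 ?addr0 => [|i ia].
      by rewrite eD ?Dc ?mem_cspan // ceps.
    by rewrite scale1r uc (negPf ia).
  split=> [x xF|]; last exact: eF.
  by rewrite sum_lfunE big1 // => i _; rewrite scale1r (u0 F).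
- by apply/lfunP => x; rewrite !comp_lfunE (p_id (pC0 x)).
all: move=> i j; rewrite -conv_proj -sum_proj; apply: on_D => [a b|F sF FD].
- rewrite cM sum_lfunE (bigD1 j) //= uc eqxx andbT [in RHS](bigD1 b) //= scale_lfunE uc eqxx andbT.
  rewrite [_ *: _]mulrC !big1 ?addr0 // => [l lb|l lj].
    by rewrite scale_lfunE uc (negPf lb) andbF scaler0.
  by rewrite uc [j == l]eq_sym (negPf lj) andbF mul0r.
- split=> [|x xF]; first by apply: ann_convl (u0 F i j sF FD); case: sF.
  by rewrite sum_lfunE big1 // => l _; rewrite scale_lfunE (u0 F) // scaler0.
- rewrite cM sum_lfunE (bigD1 i) //= uc eqxx /= [in RHS](bigD1 a) //= scale_lfunE uc eqxx /=.
  rewrite !big1 ?addr0 // => [l la|l li].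
    by rewrite scale_lfunE uc (negPf la) scaler0.
  by rewrite uc [i == l]eq_sym (negPf li) mulr0.
split=> [|x xF]; first by apply: ann_convr (u0 F i j sF FD); case: sF.
by rewrite sum_lfunE big1 // => l _; rewrite scale_lfunE (u0 F) // scaler0.
Qed.

End Bridge.

(** * Simple comodules of a comatrix coalgebra *)

Section ComatrixComodule.
Variables (k : fieldType) (C : vectType k) (cC : coalgebra C).
Variables (d : nat) (c : 'I_d -> 'I_d -> C) (phi : 'I_d -> 'I_d -> 'Hom(C, k^o)).
Hypothesis cb : comatrix_basis cC c phi.
Hypothesis d_gt0 : (0 < d)%N.

Variables (V : vectType k) (u : 'I_d -> V) (co : 'I_d -> 'Hom(V, k^o)).
Hypothesis coK : forall v, v = \sum_j co j v *: u j.
Hypothesis co_u : forall i j, co i (u j) = (i == j)%:R.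

Lemma comul_comatrix i j : comul cC (c i j) = \sum_l c i l ⊗ c l j.
Proof.
have [cM _ _] := cb; apply: tens_sep => f g; rewrite -convE cM.
by rewrite tpair_sum.
Qed.

(** The standard comodule is simple, as slicing with the dual family moves any
    nonzero vector to any basis vector. *)
Lemma comatrix_comodule : exists rV : 'Hom(V, tens V C),
  (forall j, rV (u j) = \sum_i u i ⊗ c i j) /\ simple_rcomod cC (cspan c) rV.
Proof.
have [cM ceps dualP] := cb.
have [rV rVE] : exists rV : 'Hom(V, tens V C),
    forall v, rV v = \sum_j co j v *: \sum_i u i ⊗ c i j.
  apply: linear_lfun => a v w; rewrite scaler_sumr -big_split; apply: eq_bigr => j _ /=.
  by rewrite linearP scalerDl scalerA.
have rVu j : rV (u j) = \sum_i u i ⊗ c i j.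
  rewrite rVE (bigD1 j) //= co_u eqxx scale1r [X in _ + X]big1 ?addr0 // => i ij.
  by rewrite co_u (negPf ij) scale0r.
exists rV; split=> //; split.
- split=> v; rewrite {1}[v]coK [in RHS](coK v) !linear_sum; apply: eq_bigr => j _ /=.
    rewrite !linearZ /=; congr (_ *: _); rewrite rVu !linear_sum.
    transitivity (\sum_i \sum_l tassoc V C C ((u l ⊗ c l i) ⊗ c i j)).
      apply: eq_bigr => i _ /=.
      by rewrite tmapE rVu id_lfunE tpure_suml linear_sum.
    rewrite exchange_big; apply: eq_bigr => l _ /=.
    rewrite tmapE id_lfunE comul_comatrix linear_sum; apply: eq_bigr => i _ /=.
    by rewrite tassoc_pure.
  rewrite !linearZ /=; congr (_ *: _).
  rewrite rVu linear_sum (bigD1 j) //= [tlift _ _](slicer_pure (counit cC)) ceps eqxx scale1r.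
  rewrite big1 ?addr0 // => i ij.
  by rewrite [tlift _ _](slicer_pure (counit cC)) ceps (negPf ij) scale0r.
- apply/subvP => _ /memv_imgP[v _ ->]; rewrite rVE; apply: memv_suml => j _.
  by rewrite memvZ //; apply: memv_suml => i _; rewrite memv_tens ?memvf ?mem_cspan.
- apply/eqP => V0; have : u (Ordinal d_gt0) \in (fullv : {vspace V}) by rewrite memvf.
  rewrite V0 memv0 => /eqP u0; have := co_u (Ordinal d_gt0) (Ordinal d_gt0).
  by rewrite u0 linear0 eqxx => /eqP; rewrite eq_sym oner_eq0.
move=> X /subvP rVX; have [->|nzX] := eqVneq X 0%VS; [by left | right].
have [j nzj] : exists j, co j (vpick X) != 0.
  apply: contrapT => no; case/negP: nzX; rewrite -vpick0 (coK (vpick X)); apply/eqP/big1 => j _.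
  have [->|nz] := eqVneq (co j (vpick X)) 0; first by rewrite scale0r.
  by case: no; exists j.
apply/eqP; rewrite eqEsubv subvf; apply/subvP => v _; rewrite (coK v).
apply: memv_suml => i _; rewrite memvZ //.
rewrite -[u i]scale1r -(mulVf nzj) -scalerA memvZ //.
have := slicer_tensv (phi i j) (rVX _ (memv_img rV (memv_pick X))).
suff -> : slicer V (phi i j) (rV (vpick X)) = co j (vpick X) *: u i by [].
rewrite rVE linear_sum (bigD1 j) //= linearZ linear_sum /= (bigD1 i) //=.
rewrite slicer_pure dualP !eqxx scale1r !big1 ?addr0 //.
  move=> l lj; rewrite linearZ linear_sum /= big1 ?scaler0 // => m _.
  by rewrite slicer_pure dualP [j == l]eq_sym (negPf lj) andbF scale0r.
by move=> l li; rewrite slicer_pure dualP [i == l]eq_sym (negPf li) scale0r.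
Qed.

Lemma dual_coact_comatrix (rV : 'Hom(V, tens V C)) (g : 'Hom(V, k^o)) :
    (forall j, rV (u j) = \sum_i u i ⊗ c i j) ->
  forall (Z : vectType k) (L : 'Hom(tens C (dual V), Z)),
  L (dual_coact rV g) = \sum_b L (@tpure k C (dual V) (\sum_j g (u j) *: c j b) (co b)).
Proof.
move=> rVu Z; apply: tens_sum_sep => f F; have [v Fv] := dual_eval F.
rewrite tpair_slicer.
have -> : slicer C F (dual_coact rV g) = slicel C g (rV v).
  rewrite -[RHS]dual_coactE; congr (fun_of_lfun (tlift _) _).
  by apply/funext => a; apply/funext => h; rewrite Fv.
rewrite {1}(coK v) !linear_sum; apply: eq_bigr => b _ /=.
rewrite !linearZ /= rVu Fv [RHS]mulrC; congr (_ * _); rewrite !linear_sum.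
by apply: eq_bigr => j _ /=; rewrite slicel_pure.
Qed.

End ComatrixComodule.

(** * From links to layers *)

Section MatrixBicomodule.
Variables (k : fieldType) (C : vectType k) (cC : coalgebra C) (p : 'End(C)).
Implicit Types (N X : {vspace C}).
Local Notation lh := (lh cC).
Local Notation rh := (rh cC).
Local Notation C0 := (coradical cC).

Variables (d : nat) (c : 'I_d -> 'I_d -> C) (phi : 'I_d -> 'I_d -> 'Hom(C, k^o)).
Variables (d' : nat) (c' : 'I_d' -> 'I_d' -> C) (phi' : 'I_d' -> 'I_d' -> 'Hom(C, k^o)).
Hypotheses (d_gt0 : (0 < d)%N) (cb : comatrix_basis cC c phi) (cC0 : (cspan c <= C0)%VS).
Hypotheses (d'_gt0 : (0 < d')%N) (cb' : comatrix_basis cC c' phi') (cC0' : (cspan c' <= C0)%VS).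

Variable m : 'I_d -> 'I_d' -> C.
Hypothesis rhoL_m : forall j l, rhoL cC p (m j l) = \sum_b c j b ⊗ m b l.
Hypothesis rhoR_m : forall j l, rhoR cC p (m j l) = \sum_b m j b ⊗ c' b l.

Lemma lh_phi_m i b j l : lh (phi i b \o p)%VF (m j l) = (i == j)%:R *: m b l.
Proof.
have [_ _ dualP] := cb; rewrite lh_rhoL rhoL_m linear_sum (bigD1 b) //= slicel_pure dualP.
rewrite eqxx andbT big1 ?addr0 // => b' bb'.
by rewrite slicel_pure dualP [b == b']eq_sym (negPf bb') andbF scale0r.
Qed.

Lemma rh_phi_m b i j l : rh (phi' b i \o p)%VF (m j l) = (i == l)%:R *: m j b.
Proof.
have [_ _ dualP] := cb'; rewrite rh_rhoR rhoR_m linear_sum (bigD1 b) //= slicer_pure dualP.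
rewrite eqxx big1 ?addr0 // => b' bb'.
by rewrite slicer_pure dualP [b == b']eq_sym (negPf bb') scale0r.
Qed.

(** The image of V^* (x) W under co j (x) u' l |-> m j l.  Cutting with matrix units
    on both sides recovers each coefficient of a combination of the m j l, which
    gives both injectivity and simplicity. *)
Lemma matrix_bicomodule i0 k0 : m i0 k0 != 0 ->
  exists S, [/\ simple_subbicomod cC p S, of_type cC p (cspan c) (cspan c') S,
    S != 0%VS & forall X, (forall j l, m j l \in X) -> (S <= X)%VS].
Proof.
move=> nzm0.
have [V [u [co [coK co_u]]]] := dual_bases_ex k d.
have [W [u' [co' [coK' co_u']]]] := dual_bases_ex k d'.
have [rV [rVu rVS]] := comatrix_comodule cb d_gt0 coK co_u.
have [rW [rWu rWS]] := comatrix_comodule cb' d'_gt0 coK' co_u'.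
have /choice[ev evE] (j : 'I_d) :
    exists F : 'Hom(dual V, k^o), forall g : 'Hom(V, k^o), F g = g (u j).
  by apply: linear_lfun => l g h; rewrite add_lfunE scale_lfunE.
pose coef j l (y : tens (dual V) W) : k := tpair (ev j) (co' l) y.
have coef_pure j l (g : 'Hom(V, k^o)) w :
    coef j l (@tpure k (dual V) W g w) = g (u j) * co' l w.
  by rewrite /coef tpair_pure evE.
have [f fE] : exists f : 'Hom(tens (dual V) W, C),
    forall y : tens (dual V) W, f y = \sum_j \sum_l coef j l y *: m j l.
  apply: linear_lfun => r y y'; rewrite scaler_sumr -big_split; apply: eq_bigr => j _ /=.
  rewrite scaler_sumr -big_split; apply: eq_bigr => l _ /=.
  by rewrite /coef linearP scalerDl scalerA.
have coef_sep (y : tens (dual V) W) : (forall j l, coef j l y = 0) -> y = 0.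
  move=> y0; apply: tens_sep => F G; have [v Fv] := dual_eval F; rewrite linear0.
  rewrite tpair_slicer Fv (coK v) linear_sum big1 // => j _.
  rewrite linearZ /= -evE -tpair_slicer tpair_slicel (coK' (slicel _ _ y)) linear_sum.
  rewrite big1 ?scaler0 // => l _.
  by rewrite linearZ /= -tpair_slicel [tpair _ _ _]y0 scale0r.
have corner (y : tens (dual V) W) b j b' l :
    lh (phi j b \o p)%VF (rh (phi' b' l \o p)%VF (f y)) = coef j l y *: m b b'.
  rewrite fE !linear_sum (bigD1 j) //= !linear_sum (bigD1 l) //= !linearZ /=.
  rewrite rh_phi_m eqxx scale1r lh_phi_m eqxx scale1r.
  rewrite !big1 ?addr0 // => [i ij|i il].
    rewrite !linear_sum big1 // => i' _; rewrite !linearZ /= rh_phi_m linearZ /= lh_phi_m.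
    by rewrite [j == i]eq_sym (negPf ij) scale0r !scaler0.
  by rewrite !linearZ /= rh_phi_m [l == i]eq_sym (negPf il) scale0r linear0 scaler0.
have mS b b' : m b b' \in limg f.
  have [w ww] : exists y, f y = m b b'.
    exists (@tpure k (dual V) W (co b) (u' b')); rewrite fE (bigD1 b) //= (bigD1 b') //=.
    rewrite coef_pure co_u co_u' !eqxx mulr1 scale1r !big1 ?addr0 // => [i ib|i ib].
      by rewrite big1 // => i' _; rewrite coef_pure co_u [b == i]eq_sym (negPf ib) mul0r scale0r.
    by rewrite coef_pure co_u' (negPf ib) mulr0 scale0r.
  by rewrite -ww memv_img ?memvf.
have fS_ind (X : {vspace C}) : (forall j l, m j l \in X) -> (limg f <= X)%VS.
  move=> mX; apply/subvP => _ /memv_imgP[y _ ->]; rewrite fE.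
  by apply: memv_suml => j _; apply: memv_suml => l _; rewrite memvZ.
have f_inj : lker f = 0%VS.
  apply/eqP; rewrite -subv0; apply/subvP => y; rewrite memv_ker memv0 => /eqP y0.
  apply/eqP/coef_sep => j l; have := corner y i0 j k0 l.
  rewrite y0 !linear0 => /esym/eqP; rewrite scaler_eq0 (negPf nzm0) orbF.
  by move/eqP.
exists (limg f); split=> //; last 1 first.
- by apply: contraNneq nzm0 => S0; rewrite -memv0 -S0 mS.
- split.
  + apply/andP; split; apply/subvP => _ /memv_imgP[_ /memv_imgP[y _ ->] ->].
      rewrite fE !linear_sum; apply: memv_suml => j _; rewrite !linear_sum; apply: memv_suml => l _.
      rewrite !linearZ memvZ //= rhoL_m; apply: memv_suml => b _.
      by rewrite memv_tens ?(subvP cC0) ?mem_cspan.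
    rewrite fE !linear_sum; apply: memv_suml => j _; rewrite !linear_sum; apply: memv_suml => l _.
    rewrite !linearZ memvZ //= rhoR_m; apply: memv_suml => b _.
    by rewrite memv_tens ?(subvP cC0') ?mem_cspan.
  + by apply: contraNneq nzm0 => S0; rewrite -memv0 -S0 mS.
  move=> N cN NS; have [->|nzN] := eqVneq N 0%VS; [by left | right].
  apply/eqP; rewrite eqEsubv NS; apply: fS_ind => b b'.
  have /memv_imgP[y _ yE] := subvP NS _ (memv_pick N).
  have [j [l nz]] : exists j l, coef j l y != 0.
    apply: contrapT => no; case/negP: nzN; rewrite -vpick0 yE (coef_sep y) ?linear0 // => j l.
    by apply/eqP; apply: contrapT => /negP nz; apply: no; exists j, l.
  rewrite -[m b b']scale1r -(mulVf nz) -scalerA memvZ // -(corner y b j b' l) -yE.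
  by have [NL NR] := subbicomodP cN; rewrite NL ?NR ?memv_pick.
have f_co b w : f (@tpure k (dual V) W (co b) w) = \sum_l co' l w *: m b l.
  rewrite fE (bigD1 b) //= [X in _ + X]big1 ?addr0 => [|i ib].
    by apply: eq_bigr => l _; rewrite coef_pure co_u eqxx mul1r.
  by rewrite big1 // => l _; rewrite coef_pure co_u [b == i]eq_sym (negPf ib) mul0r scale0r.
have f_u g b : f (@tpure k (dual V) W g (u' b)) = \sum_j (g : 'Hom(V, k^o)) (u j) *: m j b.
  rewrite fE; apply: eq_bigr => j _; rewrite (bigD1 b) //= coef_pure co_u' eqxx mulr1.
  by rewrite big1 ?addr0 // => l lb; rewrite coef_pure co_u' (negPf lb) mulr0 scale0r.
have fE_pure (g : 'Hom(V, k^o)) w : f (@tpure k (dual V) W g w) =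
    \sum_j \sum_l (g (u j) * co' l w) *: m j l.
  by rewrite fE; apply: eq_bigr => j _; apply: eq_bigr => l _; rewrite coef_pure.
exists V, W, rV, rW, f; split=> // y; rewrite -comp_lfunE -[RHS]comp_lfunE;
  congr (fun_of_lfun _ y); apply: tens_ext => g w; rewrite [LHS]comp_lfunE [RHS]comp_lfunE fE_pure.
- rewrite [tens_lcoact _ _ _]comp_lfunE tmapE id_lfunE.
  have [L LE] := linear_lfun (@tpure_linearl k (tens C (dual V)) W w).
  pose G := (tmap \1%VF f \o tassoc C (dual V) W \o L)%VF.
  rewrite -LE (_ : tmap \1%VF f _ = G (dual_coact rV g)); last by rewrite !comp_lfunE.
  rewrite (dual_coact_comatrix coK g rVu).
  apply: tens_sep => F F'.
  transitivity (\sum_j \sum_l \sum_b (g (u j) * co' l w) * (F (c j b) * F' (m b l))).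
    rewrite !linear_sum; apply: eq_bigr => j _; rewrite !linear_sum; apply: eq_bigr => l _ /=.
    by rewrite !linearZ /= rhoL_m tpair_sum scaler_sumr.
  under eq_bigr do rewrite exchange_big /=.
  rewrite exchange_big linear_sum; apply: eq_bigr => b _ /=.
  rewrite !comp_lfunE LE tassoc_pure tmapE id_lfunE tpair_pure f_co !linear_sum big_distrlr.
  apply: eq_bigr => j _; apply: eq_bigr => l _ /=.
  by rewrite !linearZ /= [RHS]mulrACA.
rewrite [tens_rcoact _ _ _]comp_lfunE tmapE id_lfunE {2}(coK' w).
have [L LE] := linear_lfun (@tpure_linearr k (dual V) (tens W C) g).
pose G := (tmap f \1%VF \o tassoc_inv (dual V) W C \o L \o rW)%VF.
rewrite -LE (_ : tmap f \1%VF _ = G (\sum_j co' j w *: u' j)); last by rewrite !comp_lfunE.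
apply: tens_sep => F F'.
transitivity (\sum_j \sum_l \sum_b (g (u j) * co' l w) * (F (m j b) * F' (c' b l))).
  rewrite !linear_sum; apply: eq_bigr => j _; rewrite !linear_sum; apply: eq_bigr => l _ /=.
  by rewrite !linearZ /= rhoR_m tpair_sum scaler_sumr.
rewrite exchange_big !linear_sum; apply: eq_bigr => l _ /=.
rewrite !linearZ /= !comp_lfunE rWu !linear_sum exchange_big /=.
apply: eq_bigr => b _ /=.
rewrite LE tassoc_inv_pure tmapE id_lfunE tpair_pure f_u linear_sum mulr_suml scaler_sumr.
apply: eq_bigr => j _ /=.
have -> : F (g (u j) *: m j b) = g (u j) * F (m j b) by rewrite linearZ.
by rewrite [g (u j) * _]mulrC -!mulrA.
Qed.

End MatrixBicomodule.

Section Converse.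
Variables (k : closedFieldType) (C : vectType k) (cC : coalgebra C).
Implicit Types (f g e : 'Hom(C, k^o)) (x y : C) (D E N Q S X : {vspace C}).
Local Infix "**" := (conv cC) (at level 40, left associativity).
Local Notation lh := (lh cC).
Local Notation rh := (rh cC).
Local Notation C0 := (coradical cC).
Local Notation CF := (corad_filt cC).
Local Notation simple := (simple_subcoalg cC).

Variable p : 'End(C).
Hypothesis pP : coalg_proj cC p.

Variables (n : nat) (Q : {vspace C}).
Hypothesis Q_bicomod : subbicomod cC p Q.
Hypothesis Q_add : (filt_ker cC p n + Q)%VS = filt_ker cC p n.+1.

Lemma corad_filt_dec x : x \in CF n.+1 -> exists z q, [/\ z \in CF n, q \in Q & x = z + q].
Proof.
move=> xC; have [img_p p_id _ _] := pP.
have px : p x \in C0 by rewrite -img_p memv_img ?memvf.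
have : x - p x \in filt_ker cC p n.+1.
  rewrite memv_cap rpredB //=; last exact: subvP (corad_filt_mono cC (leq0n n.+1)) _ px.
  by rewrite memv_ker linearB /= (p_id _ px) subrr.
rewrite -Q_add => /memv_addP[z zF [q qQ xE]]; exists (p x + z), q; split=> //.
  apply: memvD; first exact: subvP (corad_filt_mono cC (leq0n n)) _ px.
  by move: zF; rewrite memv_cap => /andP[].
by rewrite -addrA -xE addrC subrK.
Qed.

(** The functional of the link survives on some q in Q, and then between two
    diagonal matrix units, U i0 i0 and U' k0 k0.  Cutting q with the row i0 of U
    and the column k0 of U' gives a family in Q that spans the required simple
    bicomodule. *)
Theorem layer_of_link D E : simple D -> simple E -> link cC n D E ->
  exists S, [/\ simple_subbicomod cC p S, (S <= Q)%VS, of_type cC p D E S & S != 0%VS].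
Proof.
move=> sD sE L.
have [d [c [phi [U [d_gt0 cb Dc De [Up UL _]]]]]] := matrix_units pP sD.
have [d' [c' [phi' [U' [d'_gt0 cb' Ec' Ee' [Up' _ UR']]]]]] := matrix_units pP sE.
have [_ _ dualP] := cb; have [_ _ dualP'] := cb'.
have [a [x [aA xC nz]]] := L _ _ De Ee'.
have [z [q [zC qQ xE]]] := corad_filt_dec xC.
have {x xC xE nz} nzq : ((\sum_i U i i) ** a ** (\sum_i U' i i)) q != 0.
  apply: contra nz => /eqP q0; rewrite xE linearD /= q0 addr0; apply/eqP.
  by apply: ann_corad_filt_mulr zC; apply: ann_corad_filt_mull.
have [i0 [k0 nzm]] : exists i0 k0, (U i0 i0 ** a ** U' k0 k0) q != 0.
  apply: contrapT => no; case/negP: nzq; rewrite !conv_suml sum_lfunE.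
  apply/eqP/big1 => i _; rewrite conv_sumr sum_lfunE; apply: big1 => l _.
  by apply/eqP; apply: contrapT => /negP nz; apply: no; exists i, l.
pose m j l := lh (U i0 j) (rh (U' l k0) q).
have mE g j l : g (m j l) = (U i0 j ** g ** U' l k0) q by rewrite lhE rhE.
have nzm0 : m i0 k0 != 0 by apply: contraNneq nzm => m0; rewrite -mE m0 linear0.
have rhoL_m j l : rhoL cC p (m j l) = \sum_b c j b ⊗ m b l.
  apply: tens_sep => f g; rewrite tpair_rhoL tpair_sum mE convA UL !conv_suml sum_lfunE.
  by apply: eq_bigr => b _; rewrite !convZl scale_lfunE mE.
have rhoR_m j l : rhoR cC p (m j l) = \sum_b m j b ⊗ c' b l.
  apply: tens_sep => f g; rewrite tpair_rhoR tpair_sum mE -!convA UR' !conv_sumr sum_lfunE.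
  by apply: eq_bigr => b _; rewrite !convZr scale_lfunE mE -convA [RHS]mulrC.
have [QL QR] := subbicomodP Q_bicomod.
have mQ j l : m j l \in Q by rewrite /m -Up -Up' QL ?QR.
have [cC0 cC0'] : (cspan c <= C0)%VS /\ (cspan c' <= C0)%VS.
  by rewrite -Dc -Ec'; split; apply: simple_sub_coradical.
have [S [S_simple S_type nzS subS]] :=
  matrix_bicomodule d_gt0 cb cC0 d'_gt0 cb' cC0' rhoL_m rhoR_m nzm0.
by exists S; split=> //; [apply: subS | rewrite Dc Ec'].
Qed.

End Converse.

Section BlockLinks.
Variables (k : closedFieldType) (C : vectType k) (cC : coalgebra C) (B : block_system cC).

Definition simple_of_degree (d : nat) (D : {vspace C}) : Prop :=
  simple_subcoalg cC D /\ \dim D = (d ^ 2)%N.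

Lemma block_link n d1 d2 : block B n.+1 d1 d2 != 0%VS <->
  exists D E, [/\ simple_of_degree d1 D, simple_of_degree d2 E & link cC n D E].
Proof.
have [pP cQ addQ capQ] := And4 (bs_projP B) (bs_Q_sub B n) (bs_Q_add B n) (bs_Q_cap B n).
split=> [/vsum_nz[X [D [E [[sD dD] [sE dE] ->]]]] | [D [E [[sD dD] [sE dE] L]]]].
  move=> /vsum_nz[S [S_simple SQ S_type] nzS]; exists D, E; split=> //.
  exact: (layer_link pP addQ capQ sD sE S_type SQ nzS).
have [S [S_simple SQ S_type nzS]] := layer_of_link pP cQ addQ sD sE L.
apply: (@vsum_sup _ _ _ (isotypic cC (bs_proj B) (bs_Q B n.+1) D E)).
  by exists D, E.
by apply: vsum_sup nzS.
Qed.

End BlockLinks.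

(** * Blocks of a Hopf algebra *)

Section HopfBlocks.
Variables (k : closedFieldType) (H : falgType k) (hH : hopf_algebra H) (B : block_system hH).

Lemma antipode_similitude : similitude hH (antipode hH).
Proof.
split; [exact: antipode_inj | | right; exact: antipode_antihom].
by apply/lfunP => x; rewrite comp_lfunE counit_antipode.
Qed.

Lemma block_split i j d1 d2 : block B (i + j).+2 d1 d2 != 0%VS ->
  exists b, [/\ (0 < b)%N, block B i.+1 d1 b != 0%VS & block B j.+1 b d2 != 0%VS].
Proof.
move=> /block_link[D [E [[sD dD] [sE dE] L]]].
have [F [sF LDF LFE]] := link_split sD sE L.
have [b b_gt0 dF] := simple_dim sF; exists b; split=> //; apply/block_link.
  by exists D, F.
by exists F, E.
Qed.

Lemma block_transpose n d1 d2 : block B n.+1 d1 d2 != 0%VS -> block B n.+1 d2 d1 != 0%VS.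
Proof.
move=> /block_link[D [E [[sD dD] [sE dE] L]]]; apply/block_link.
have S := antipode_similitude.
exists (antipode hH @^-1: E)%VS, (antipode hH @^-1: D)%VS; split.
- by split; [exact: simple_preim S _ sE | rewrite (dim_preim S)].
- by split; [exact: simple_preim S _ sD | rewrite (dim_preim S)].
exact: (link_antihom S sD sE (@antipode_antihom _ _ hH)).
Qed.

(** Under this hypothesis nothing is linked to D further out than the given link
    from D to E, so that [frobenius_socle] applies. *)
Lemma block_top n d1 d2 : block B n.+1 d1 d2 != 0%VS ->
    (forall m d3, (n < m)%N -> (0 < d3)%N -> block B m.+1 d1 d3 = 0%VS) -> d1 = d2.
Proof.
move=> /block_link[D [E [[sD dD] [sE dE] L]]] top.
have [e De] := indicator_ex sD; have pP := bs_projP B.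
have [t nzt t_int] := left_integral_ex hH.
have t_nondeg f : rh hH f t = 0 -> f = 0 by apply: left_integral_nondeg.
have Dp := indicator_proj pP sD De; have ee := indicator_proj_idem pP sD De.
have dDE : \dim D = \dim E.
  apply: (frobenius_socle t_nondeg sD sE Dp ee L) => a aA.
  apply: (link_vanish sD Dp ee _ aA) => m F nm sF LF.
  have [d3 d3_gt0 dF] := simple_dim sF.
  suff /eqP : block B m.+1 d1 d3 != 0%VS by rewrite top.
  by apply/block_link; exists D, F.
by apply/eqP; rewrite -eqn_sqr -dD -dE dDE.
Qed.

End HopfBlocks.

Theorem corollary2p13 (k : closedFieldType) (char_k : [pchar k] =i pred0)
    (H : falgType k) (hH : hopf_algebra H) (ncs : ~ cosemisimple hH)
    (B : block_system hH) (d1 d2 : nat) (d1_gt0 : (0 < d1)%N) (d2_gt0 : (0 < d2)%N) :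
  [/\ forall n : nat, (1 < n)%N -> block B n d1 d2 != 0%VS ->
        exists b : nat -> nat, forall i : nat, (1 <= i <= n - 1)%N ->
          [/\ (0 < b i)%N, block B i d1 (b i) != 0%VS
            & block B (n - i) (b i) d2 != 0%VS],
      forall n : nat, (1 <= n)%N -> block B n d1 d2 != 0%VS ->
        block B n d2 d1 != 0%VS
    & forall n1 : nat, (1 <= n1)%N -> block B n1 d1 d2 != 0%VS -> d1 <> d2 ->
        exists2 d3 : nat, (0 < d3)%N &
          exists2 n2 : nat, (n1 + 1 <= n2)%N & block B n2 d1 d3 != 0%VS].
Proof.
split=> [n n_gt1 nz | [|n] // _ | [|n] // _ nz d12]; last 2 first.
- exact: block_transpose.
- apply: contrapT => no; apply: d12; apply: block_top nz _ => m d3 nm d3_gt0.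
  apply/eqP; apply: contrapT => /negP nz; apply: no; exists d3 => //; exists m.+1 => //.
  by rewrite addn1.
suff /choice[b bP] : forall i, exists b, (1 <= i <= n - 1)%N ->
    [/\ (0 < b)%N, block B i d1 b != 0%VS & block B (n - i) b d2 != 0%VS].
  by exists b.
move=> i; have [/andP[i_gt0 i_lt]|/negP ni] := boolP (1 <= i <= n - 1)%N; last by exists 0%N.
case: i i_gt0 i_lt => // i _ i_lt.
have [j nE] : exists j, n = (i + j).+2.
  exists (n - i.+2)%N; rewrite -!addSn subnKC //.
  by move: i_lt; rewrite -[n](prednK (ltnW n_gt1)) subn1.
rewrite nE in nz *; have [b [b_gt0 Lb Rb]] := block_split nz; exists b => _.
by split=> //; rewrite -addSn -addnS addKn.
Qed.
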